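(* Let $\mathcal{C}:\mathcal{Q}Sym\to\mathcal{Y}Sym$, $\Gamma:\mathcal{Y}Sym\to\mathfrak{S}Sym$ and $\mathcal{Z}:\mathcal{Q}Sym\to\mathfrak{S}Sym$ be the linear maps $\mathcal{C}(M_{\mathsf{S}})=M_{C(\mathsf{S})}$, $\Gamma(M_t)=M_{\gamma(t)}$, $\mathcal{Z}(M_{\mathsf{S}})=M_{Z(\mathsf{S})}$. Then $\mathcal{C},\Gamma,\mathcal{Z}$ are injective morphisms of coalgebras, $\Gamma\circ\mathcal{C}=\mathcal{Z}$, and they split the surjections $\mathcal{L},\Lambda,\mathcal{D}$: $\mathcal{L}\circ\mathcal{C}=\mathrm{id}_{\mathcal{Q}Sym}$, $\Lambda\circ\Gamma=\mathrm{id}_{\mathcal{Y}Sym}$, $\mathcal{D}\circ\mathcal{Z}=\mathrm{id}_{\mathcal{Q}Sym}$.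
   Context: Permutations in one-line notation; $\mathrm{st}$ standardizes a sequence of distinct integers to a permutation with the same relative order. Weak order on $\mathfrak{S}_n$: inclusion of inversion sets. For $\sigma\in\mathfrak{S}_p,\tau\in\mathfrak{S}_q$: $\sigma\vee\tau=(\sigma(1)+q,..,\sigma(p)+q,p+q+1,\tau(1),..,\tau(q))$, $\sigma\backslash\tau=(\sigma(1)+q,..,\sigma(p)+q,\tau(1),..,\tau(q))$. $\mathrm{Des}(\sigma)=\{i:\sigma(i)>\sigma(i+1)\}$. For $\mathsf{S}=\{p_1<\dots<p_k\}\subseteq[n-1]$, $Z(\mathsf{S})=\mathrm{id}_{p_1}\backslash\mathrm{id}_{p_2-p_1}\backslash\cdots\backslash\mathrm{id}_{n-p_k}$. Trees: $\mathcal{Y}_n$ = rooted planar binary trees with $n$ internal nodes, $\mathcal{Y}_0=\{|\}$; $s\vee t$ = root with left subtree $s$, right subtree $t$. Tamari order generated by replacing a subtree $(a\vee b)\vee c$ by the larger $a\vee(b\vee c)$. $s\backslash t$: $|\backslash t=t$, $s\backslash t=s_l\vee(s_r\backslash t)$. $1_0=|$, $1_n=1_{n-1}\vee|$, $C(\mathsf{S})=1_{p_1}\backslash\cdots\backslash1_{n-p_k}$. $L(t)$: with leaves numbered $0..n$, the set of $i\in[n-1]$ with leaf $i$ a left child. $\lambda(\mathrm{id}_0)=|$, $\lambda(\sigma)=\lambda(\mathrm{st}(\sigma(1..j-1)))\vee\lambda(\mathrm{st}(\sigma(j+1..n)))$, $j=\sigma^{-1}(n)$; $\gamma(|)=\mathrm{id}_0$,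 $\gamma(t)=\gamma(t_l)\vee\gamma(t_r)$. Hopf algebras over $\mathbb{Q}$: $\mathfrak{S}Sym$ has basis $F_\sigma$ with coproduct $\Delta(F_\sigma)=\sum_{p=0}^nF_{\mathrm{st}(\sigma(1),..,\sigma(p))}\otimes F_{\mathrm{st}(\sigma(p+1),..,\sigma(n))}$ and $M_\sigma=\sum_{\sigma\le\tau}\mu_{\mathfrak{S}_n}(\sigma,\tau)F_\tau$. $\mathcal{Y}Sym$ has basis $F_t$ with coproduct $\Delta(F_t)=\sum_iF_{t_0}\otimes F_{t_1}$ over splittings $t\to(t_0,t_1)$ at leaves $i=0..n$, defined recursively by $|\to(|,|)$ and, for $t=t_l\vee t_r$, $t\to(a,b\vee t_r)$ if the leaf is in $t_l$ and $t_l\to(a,b)$, $t\to(t_l\vee c,d)$ if the leaf is in $t_r$ and $t_r\to(c,d)$; and $M_t=\sum_{t\le s}\mu_{\mathcal{Y}_n}(t,s)F_s$. $\mathcal{Q}Sym$ has in degree $n$ bases $M_{\mathsf{S}},F_{\mathsf{S}}$, $\mathsf{S}\subseteq[n-1]$, with $F_{\mathsf{S}}=\sum_{\mathsf{T}\supseteq\mathsf{S}}M_{\mathsf{T}}$; identifying $\mathsf{S}=\{p_1<\dots<p_k\}$ with the composition $(a_1,\dots,a_{k+1})=(p_1,p_2-p_1,\dots,n-p_k)$, the coproduct is $\Delta(M_{(a_1,\dots,a_m)})=\sum_{i=0}^mM_{(a_1,\dots,a_i)}\otimes M_{(a_{i+1},\dots,a_m)}$. The Hopf morphisms $\Lambda:\mathfrak{S}Sym\to\mathcal{Y}Sym$,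 $\mathcal{L}:\mathcal{Y}Sym\to\mathcal{Q}Sym$, $\mathcal{D}:\mathfrak{S}Sym\to\mathcal{Q}Sym$ are $F_\sigma\mapsto F_{\lambda(\sigma)}$, $F_t\mapsto F_{L(t)}$, $F_\sigma\mapsto F_{\mathrm{Des}(\sigma)}$. *)

(* Defs.v *)
From HB Require Import structures.
From mathcomp Require Import all_boot all_order all_algebra.
From mathcomp Require Import freeg.

Set Implicit Arguments.
Unset Strict Implicit.
Unset Printing Implicit Defensive.

Import Order.TTheory GRing.Theory Num.Theory.
Local Open Scope ring_scope.

(* Möbius function of a finite poset (T, le): the inverse of the zeta
   function in the incidence algebra, i.e. the inverse of the zeta matrix
   Z(x,y) = [x <= y]. *)
Definition mobius (T : finType) (le : rel T) (x y : T) : rat :=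
  let Z : 'M[rat]_#|T| := \matrix_(i, j) (le (enum_val i) (enum_val j))%:R in
  invmx Z (enum_rank x) (enum_rank y).

(* Tensor product of free vector spaces: basis = pairs of basis elements. *)
Definition tens (K1 K2 : choiceType) (u : {freeg K1 / rat}) (v : {freeg K2 / rat})
  : {freeg (K1 * K2)%type / rat} :=
  fglift (fun x : K1 => fglift (fun y : K2 => << (x, y) >> : {freeg (K1 * K2)%type / rat}) v) u.

Definition tmap (K1 K2 K3 K4 : choiceType)
  (f : {freeg K1 / rat} -> {freeg K3 / rat}) (g : {freeg K2 / rat} -> {freeg K4 / rat})
  (w : {freeg (K1 * K2)%type / rat}) : {freeg (K3 * K4)%type / rat} :=
  fglift (fun p : K1 * K2 => tens (f << p.1 >>) (g << p.2 >>)) w.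

(* all subsequences of a list (subsets when the list is sorted) *)
Fixpoint subseqs (s : seq nat) : seq (seq nat) :=
  match s with
  | [::] => [:: [::]]
  | x :: s' => [seq x :: t | t <- subseqs s'] ++ subseqs s'
  end.

Definition is_perm (s : seq nat) : bool := perm_eq s (iota 1 (size s)).
Definition perm_key := {s : seq nat | is_perm s}.
Definition perm0 : perm_key := exist _ [::] (erefl true).
Definition mkperm (s : seq nat) : perm_key := insubd perm0 s.

Definition st (s : seq nat) : seq nat := [seq (count (fun y => y < x)%N s).+1 | x <- s].

Definition pvee (s t : seq nat) : seq nat :=
  [seq (x + size t)%N | x <- s] ++ (size s + size t).+1 :: t.
Definition pbsl (s t : seq nat) : seq nat := [seq (x + size t)%N | x <- s] ++ t.
Definition idp (n : nat) : seq nat := iota 1 n.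

Definition inversions (s : seq nat) : seq (nat * nat) :=
  [seq ij <- [seq (i, j) | i <- iota 0 (size s), j <- iota 0 (size s)]
     | (ij.1 < ij.2)%N && (nth 0 s ij.2 < nth 0 s ij.1)%N].
Definition weak_le (s t : seq nat) : bool := all (fun ij => ij \in inversions t) (inversions s).

Definition Des (s : seq nat) : seq nat :=
  [seq i <- iota 1 (size s).-1 | (nth 0 s i < nth 0 s i.-1)%N].

Definition permsn (n : nat) : seq (seq nat) := permutations (idp n).
Lemma idp_in_permsn n : idp n \in permsn n.
Proof. by rewrite mem_permutations perm_refl. Qed.
Definition PermN (n : nat) : finType := seq_sub (permsn n).
Definition to_permn (n : nat) (s : seq nat) : PermN n :=
  insubd (SeqSub (idp_in_permsn n) : PermN n) s.
Definition weak_leN (n : nat) : rel (PermN n) := fun a b => weak_le (val a) (val b).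

Inductive tree := Leaf | Node of tree & tree.

Fixpoint tree_enc (t : tree) : GenTree.tree nat :=
  match t with
  | Leaf => GenTree.Node 0 [::]
  | Node l r => GenTree.Node 1 [:: tree_enc l; tree_enc r]
  end.
Fixpoint tree_dec (g : GenTree.tree nat) : option tree :=
  match g with
  | GenTree.Node 0 [::] => Some Leaf
  | GenTree.Node 1 [:: a; b] =>
      match tree_dec a, tree_dec b with
      | Some l, Some r => Some (Node l r)
      | _, _ => None
      end
  | _ => None
  end.
Lemma tree_encK : pcancel tree_enc tree_dec.
Proof. by elim=> [|l IHl r IHr] //=; rewrite IHl IHr. Qed.
HB.instance Definition _ := Countable.copy tree (pcan_type tree_encK).

Fixpoint tsize (t : tree) : nat :=
  match t with Leaf => 0%N | Node l r => (tsize l + tsize r).+1 end.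

Fixpoint tbsl (s t : tree) : tree :=
  match s with Leaf => t | Node sl sr => Node sl (tbsl sr t) end.

Fixpoint lcomb (n : nat) : tree :=
  match n with 0 => Leaf | n'.+1 => Node (lcomb n') Leaf end.

(* lambda : permutations -> trees; fuel = size s suffices since the two
   recursive arguments have size < size s *)
Fixpoint lam_rec (k : nat) (s : seq nat) : tree :=
  match k with
  | 0 => Leaf
  | k'.+1 =>
      if s is [::] then Leaf else
      let j := index (\max_(x <- s) x)%N s in
      Node (lam_rec k' (st (take j s))) (lam_rec k' (st (drop j.+1 s)))
  end.
Definition lambda (s : seq nat) : tree := lam_rec (size s) s.

Fixpoint gamma (t : tree) : seq nat :=
  match t with Leaf => [::] | Node l r => pvee (gamma l) (gamma r) end.

Fixpoint leaf_flags (t : tree) (isleft : bool) : seq bool :=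
  match t with Leaf => [:: isleft] | Node l r => leaf_flags l true ++ leaf_flags r false end.
Definition Lset (t : tree) : seq nat :=
  [seq i <- iota 1 (tsize t).-1 | nth false (leaf_flags t false) i].

(* splittings t -> (t0, t1) at the leaves 0..n *)
Fixpoint splits (t : tree) : seq (tree * tree) :=
  match t with
  | Leaf => [:: (Leaf, Leaf)]
  | Node l r => [seq (ab.1, Node ab.2 r) | ab <- splits l]
                ++ [seq (Node l cd.1, cd.2) | cd <- splits r]
  end.

Fixpoint rots (t : tree) : seq tree :=
  match t with
  | Leaf => [::]
  | Node l r =>
      (if l is Node a b then [:: Node a (Node b r)] else [::])
      ++ [seq Node l' r | l' <- rots l] ++ [seq Node l r' | r' <- rots r]
  end.

Fixpoint trees_h (k : nat) : seq tree :=
  match k with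
  | 0 => [:: Leaf]
  | k'.+1 => Leaf :: [seq Node lr.1 lr.2 | lr <- [seq (l, r) | l <- trees_h k', r <- trees_h k']]
  end.
Definition treesn (n : nat) : seq tree := [seq t <- trees_h n | tsize t == n].
Lemma leaf_in_trees_h k : Leaf \in trees_h k.
Proof. by case: k => //= k; rewrite in_cons eqxx. Qed.
Lemma lcomb_in_treesn n : lcomb n \in treesn n.
Proof.
have h : tsize (lcomb n) = n by elim: n => //= n ->; rewrite addn0.
rewrite mem_filter h eqxx /=.
elim: n {h} => [|n IH] //=; rewrite in_cons; apply/orP; right.
apply/mapP; exists (lcomb n, Leaf) => //; apply/allpairsP; exists (lcomb n, Leaf).
by split => //; apply: leaf_in_trees_h.
Qed.
Definition TreeN (n : nat) : finType := seq_sub (treesn n).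
Definition to_treen (n : nat) (t : tree) : TreeN n :=
  insubd (SeqSub (lcomb_in_treesn n) : TreeN n) t.
Definition tam_leN (n : nat) : rel (TreeN n) :=
  connect (fun a b : TreeN n => val b \in rots (val a)).

Definition is_comp (c : seq nat) : bool := all (fun a => 0 < a)%N c.
Definition comp_key := {c : seq nat | is_comp c}.
Definition comp0 : comp_key := exist _ [::] (erefl true).
Definition mkcomp (c : seq nat) : comp_key := insubd comp0 c.

(* S = {p1 < ... < pk} subset of [n-1]  |->  (p1, p2-p1, ..., n-pk) *)
Definition comp_of_set (n : nat) (S : seq nat) : seq nat :=
  if n == 0%N then [::] else pairmap (fun a b => b - a)%N 0%N (rcons S n).

Definition Cmap (c : seq nat) : tree := foldr tbsl Leaf (map lcomb c).
Definition Zmap (c : seq nat) : seq nat := foldr pbsl [::] (map idp c).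

(* SSym, coordinates in the F basis *)
Definition SSym := {freeg perm_key / rat}.
Definition FS (s : seq nat) : SSym := << mkperm s >>.
Definition MS (s : seq nat) : SSym :=
  let n := size s in
  \sum_(u : PermN n | weak_leN (to_permn n s) u)
     mobius (@weak_leN n) (to_permn n s) u *: FS (val u).
Definition DeltaS (v : SSym) : {freeg (perm_key * perm_key)%type / rat} :=
  fglift (fun x : perm_key =>
    \sum_(p < (size (val x)).+1)
      << (mkperm (st (take p (val x))), mkperm (st (drop p (val x)))) >>
      : {freeg (perm_key * perm_key)%type / rat}) v.
Definition epsS (v : SSym) : rat^o :=
  fglift (fun x : perm_key => ((size (val x) == 0%N)%:R : rat^o)) v.

(* YSym, coordinates in the F basis *)
Definition YSym := {freeg tree / rat}.
Definition FY (t : tree) : YSym := << t >>.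
Definition MY (t : tree) : YSym :=
  let n := tsize t in
  \sum_(s : TreeN n | tam_leN (to_treen n t) s)
     mobius (@tam_leN n) (to_treen n t) s *: FY (val s).
Definition DeltaY (v : YSym) : {freeg (tree * tree)%type / rat} :=
  fglift (fun t : tree =>
    \sum_(ab <- splits t) << ab >> : {freeg (tree * tree)%type / rat}) v.
Definition epsY (v : YSym) : rat^o :=
  fglift (fun t : tree => ((t == Leaf)%:R : rat^o)) v.

(* QSym, coordinates in the M basis (indexed by compositions) *)
Definition QSym := {freeg comp_key / rat}.
Definition MQ (c : seq nat) : QSym := << mkcomp c >>.
Definition FQ (n : nat) (S : seq nat) : QSym :=
  \sum_(T <- subseqs (iota 1 n.-1) | all (fun i => i \in T) S) MQ (comp_of_set n T).
Definition DeltaQ (v : QSym) : {freeg (comp_key * comp_key)%type / rat} :=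
  fglift (fun c : comp_key =>
    \sum_(i < (size (val c)).+1)
      << (mkcomp (take i (val c)), mkcomp (drop i (val c))) >>
      : {freeg (comp_key * comp_key)%type / rat}) v.
Definition epsQ (v : QSym) : rat^o :=
  fglift (fun c : comp_key => ((val c == [::])%:R : rat^o)) v.

Definition LambdaM (v : SSym) : YSym := fglift (fun x : perm_key => FY (lambda (val x))) v.
Definition LM (v : YSym) : QSym := fglift (fun t : tree => FQ (tsize t) (Lset t)) v.
Definition DM (v : SSym) : QSym := fglift (fun x : perm_key => FQ (size (val x)) (Des (val x))) v.

(* C and Z, defined on the M basis of QSym (= its coordinate basis) *)
Definition CM (v : QSym) : YSym := fglift (fun c : comp_key => MY (Cmap (val c))) v.
Definition ZM (v : QSym) : SSym := fglift (fun c : comp_key => MS (Zmap (val c))) v.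

(* Main.v *)
From HB Require Import structures.
From Stdlib Require Import Relation_Operators.
From mathcomp Require Import all_boot all_algebra.
From mathcomp Require Import freeg zify.
Require Import Defs.
Import GRing.Theory.

Set Implicit Arguments.
Unset Strict Implicit.
Unset Printing Implicit Defensive.

(** Record a permutation by its noninversions and a tree [t] by the pairs [(i, j)] of
    nodes, numbered in-order, such that [i] lies in the left subtree of [j]; these are
    the noninversions of [gamma t]. The weak order and the Tamari order both become
    reverse inclusion, [a \ b] is the juxtaposition of the two relations, and splitting
    restricts a relation to an initial and a final segment, whence [x <= a \ b] iff
    [x_0 <= a] and [x_1 <= b], where [(x_0, x_1)] is the splitting of [x] into the sizes
    of [a] and [b]. In the same language [lambda s <= t] iff [s <= gamma t], and
    [t <= C(S)] iff [L(t)] is contained in [S].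

    Since [F_x] is the sum of the [M_y] over [y >= x], a linear map such that
    [f (F_x) = sum_{y >= x} k y] for all [x] satisfies [f (M_x) = k x]. The three
    equivalences thus give [Delta (M_x) = sum_{a \ b = x} M_a (x) M_b],
    [Lambda (M_{gamma t}) = M_t] and [L (M_{C(S)}) = M_S]. The factorizations [a \ b] of
    [gamma t] are the images of those of [t], and those of [C(S)] come from cutting the
    composition of [S]; the claims on [Z] and [D] follow from [Z = Gamma C] and
    [D = L Lambda]. *)

Local Open Scope ring_scope.

(** * Moebius inversion *)

Definition poset_on (I : eqType) (E : seq I) (le : rel I) : Prop :=
  [/\ {in E, reflexive le}, {in E &, antisymmetric le} & {in E & &, transitive le}].

Definition upsum (I : Type) (V : nmodType) (E : seq I) (le : rel I) (f : I -> V)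
    (x : I) : V :=
  \sum_(y <- E | le x y) f y.

Lemma eq_in_bigl (I : eqType) (V : nmodType) (E : seq I) (P Q : pred I) (f : I -> V) :
  {in E, P =1 Q} -> \sum_(i <- E | P i) f i = \sum_(i <- E | Q i) f i.
Proof.
move=> eqPQ; rewrite big_seq_cond [RHS]big_seq_cond.
by apply: eq_bigl => i; case: (boolP (i \in E)) => //= /eqPQ.
Qed.

Lemma upsum_inj (I : eqType) (V : zmodType) (E : seq I) (le : rel I) (f g : I -> V) :
  uniq E -> poset_on E le -> {in E, upsum E le f =1 upsum E le g} -> {in E, f =1 g}.
Proof.
move=> uE [le_refl le_anti le_trans] eq_fg x.
have [m] := ubnP (count (le x) E); elim: m x => // m IHm x lt_xm Ex.
have upsumD1 (h : I -> V) :
    upsum E le h x = h x + \sum_(y <- E | y != x) if le x y then h y else 0.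
  by rewrite /upsum big_mkcond (bigD1_seq x) //= le_refl.
have := eq_fg x Ex; rewrite !upsumD1 => eq_sum; apply: addIr (etrans eq_sum _).
congr (_ + _); rewrite big_seq_cond [RHS]big_seq_cond.
apply: eq_bigr => y /andP[Ey ne_yx]; case: ifP => // le_xy.
suff /IHm-> : (count (le y) E < m)%N by [].
have lt_yx : (count (le y) E < count (le x) E)%N.
  rewrite -!size_filter; apply: (uniq_leq_size (s1 := x :: _)) => [|z].
    rewrite /= filter_uniq // mem_filter Ex andbT andbT; apply: contra ne_yx => le_yx.
    by apply/eqP/le_anti; rewrite ?le_yx.
  rewrite inE !mem_filter => /predU1P[->|/andP[le_yz Ez]]; first by rewrite le_refl.
  by rewrite (le_trans y).
exact: leq_trans lt_yx lt_xm.
Qed.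

Section FinitePoset.

Variables (T : finType) (le : rel T).
Hypothesis le_poset : poset_on (index_enum T) le.

Lemma sum_enum_rank (V : nmodType) (f : 'I_#|T| -> V) :
  \sum_i f i = \sum_x f (enum_rank x).
Proof. by rewrite (reindex enum_rank) //; apply/onW_bij/enum_rank_bij. Qed.

Lemma zeta_unitmx :
  (\matrix_(i, j) (le (enum_val i) (enum_val j))%:R : 'M[rat]_#|T|) \in unitmx.
Proof.
rewrite -unitmx_tr -row_free_unit; apply: inj_row_free => v vZ0; apply/rowP => i.
rewrite [RHS]mxE -(enum_valK i).
apply: (@upsum_inj T _ _ le (fun x => v 0 (enum_rank x)) (fun=> 0)
  (index_enum_uniq T) le_poset) => // x _.
have := congr1 (fun m : 'rV_#|T| => m 0 (enum_rank x)) vZ0.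
rewrite !mxE sum_enum_rank => sum0.
rewrite /upsum [RHS]big1 // -[RHS]sum0 big_mkcond /=.
by apply: eq_bigr => y _; rewrite !mxE !enum_rankK mulr_natr mulrb.
Qed.

Lemma upsum_mobius_col x z : upsum (index_enum T) le (mobius le ^~ z) x = (x == z)%:R.
Proof.
have := congr1 (fun m : 'M_#|T| => m (enum_rank x) (enum_rank z)) (mulmxV zeta_unitmx).
rewrite !mxE (inj_eq enum_rank_inj) sum_enum_rank => <-; rewrite /upsum big_mkcond /=.
by apply: eq_bigr => y _; rewrite mxE !enum_rankK mulr_natl mulrb.
Qed.

Lemma mobius_eq0 x z : ~~ le x z -> mobius le x z = 0.
Proof.
have [le_refl le_anti le_trans] := le_poset.
pose E := [seq y <- index_enum T | ~~ le y z].
have memE y : (y \in E) = ~~ le y z by rewrite mem_filter mem_index_enum andbT.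
move=> nle_xz; have Ex : x \in E by rewrite memE.
apply: (@upsum_inj T _ E le (mobius le ^~ z) (fun=> 0)) Ex.
- exact/filter_uniq/index_enum_uniq.
- by split=> [y _|y1 y2 _ _|y1 y2 y3 _ _ _];
    [apply: le_refl|apply: le_anti|apply: le_trans]; rewrite ?mem_index_enum.
move=> y; rewrite memE => nle_yz; rewrite [RHS]big1 //.
have ne_yz : y == z = false.
  by apply: contraNF nle_yz => /eqP->; apply: le_refl; rewrite mem_index_enum.
transitivity (upsum (index_enum T) le (mobius le ^~ z) y); last first.
  by rewrite upsum_mobius_col ne_yz.
rewrite /upsum big_filter_cond; apply: eq_bigl => u /=; rewrite andb_idl // => le_yu.
by apply: contra nle_yz; apply: le_trans le_yu; rewrite mem_index_enum.
Qed.

Lemma upsum_mobius (V : lmodType rat) (F : T -> V) x :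
  upsum (index_enum T) le (fun y => \sum_(z | le y z) mobius le y z *: F z) x = F x.
Proof.
transitivity (\sum_(y | le x y) \sum_z mobius le y z *: F z).
  apply: eq_bigr => y _; rewrite big_mkcond; apply: eq_bigr => z _.
  by case: ifPn => // /mobius_eq0->; rewrite scale0r.
rewrite exchange_big (bigD1 x) //= [X in _ + X]big1 ?addr0 => [|z /negbTE ne_zx];
  rewrite -scaler_suml -/(upsum _ _ (mobius le ^~ _) x) upsum_mobius_col.
  by rewrite eqxx scale1r.
by rewrite eq_sym ne_zx scale0r.
Qed.

End FinitePoset.

Lemma upsum_seq_sub (I : choiceType) (V : nmodType) (E : seq I) (le : rel I)
    (f : I -> V) (x : seq_sub E) : uniq E ->
  upsum (index_enum (seq_sub E)) (relpre val le) (f \o val) x = upsum E le f (val x).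
Proof.
move=> uE; rewrite /upsum -(big_map val (le (val x)) f); apply: perm_big.
apply: uniq_perm => //.
  by rewrite map_inj_uniq ?index_enum_uniq //; apply: val_inj.
move=> y; apply/mapP/idP => [[z _ ->]|Ey]; first exact: (valP z).
by exists (SeqSub Ey) => //; rewrite mem_index_enum.
Qed.

(* The hypothesis on [M] is the definition of the monomial basis of [SSym] or [YSym] in
   one degree, with [seq_sub E] the type of indices of that degree. *)
Lemma upsum_monomial (I : choiceType) (V : lmodType rat) (E : seq I) (le : rel I)
    (leE : rel (seq_sub E)) (F M : I -> V) :
  uniq E -> poset_on E le -> leE =2 relpre val le ->
  (forall u, M (val u) = \sum_(v | leE u v) mobius leE u v *: F (val v)) ->
  {in E, F =1 upsum E le M}.
Proof.
move=> uE [le_refl le_anti le_trans] leEE defM x Ex.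
have leE_poset : poset_on (index_enum (seq_sub E)) leE.
  split=> [u _|u v _ _|v u w _ _ _]; rewrite !leEE /=; first exact: le_refl (valP u).
    by move=> le_uv; apply/val_inj/le_anti; rewrite ?(valP u) ?(valP v).
  exact: le_trans (valP v) (valP u) (valP w).
rewrite -[LHS](upsum_mobius leE_poset (F \o val) (SeqSub Ex)).
rewrite -(upsum_seq_sub le M (SeqSub Ex) uE) /upsum.
by apply: eq_big => [u|u _]; rewrite ?leEE //= defM.
Qed.

Section LinearOnMonomials.

Variables (R : nzRingType) (I J : eqType) (U V : lmodType R) (f : {linear U -> V}).
Variables (E : seq I) (le : rel I) (F M : I -> U).
Hypotheses (uE : uniq E) (le_poset : poset_on E le) (FM : {in E, F =1 upsum E le M}).

Lemma linear_monomial (k : I -> V) :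
  {in E, f \o F =1 upsum E le k} -> {in E, f \o M =1 k}.
Proof.
move=> fF; apply: (upsum_inj uE le_poset) => x Ex.
by rewrite -fF //= FM // linear_sum.
Qed.

(* If [le x (c y)] is equivalent to [le' (d x) y] for an order [le'] on [J], then the
   sum in the hypothesis is the upper sum of [N] at [d x]: this is how Galois connections
   enter. *)
Lemma linear_monomial_pushforward (E' : seq J) (c : J -> I) (N : J -> V) :
  {in E', forall y, c y \in E} ->
  {in E, forall x, f (F x) = \sum_(y <- E' | le x (c y)) N y} ->
  {in E, forall x, f (M x) = \sum_(y <- E' | c y == x) N y}.
Proof.
move=> cE fF; apply: linear_monomial => x Ex; rewrite /= fF // /upsum.
rewrite (exchange_big_dep predT) //= big_mkcond; apply: eq_big_seq => y Ey /=.
rewrite -big_filter; case: ifPn => le_xcy.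
  rewrite (bigD1_seq (c y)) ?filter_uniq ?mem_filter ?le_xcy ?eqxx ?cE //=.
  by rewrite big_filter_cond big1 ?addr0 // => z /andP[/andP[_ /eqP->]]; rewrite eqxx.
by rewrite big_filter big1 // => z /andP[le_xz /eqP cyz]; rewrite cyz le_xz in le_xcy.
Qed.

Lemma linear_monomial_galois (E' : seq J) (c : J -> I) (N : J -> V) :
  uniq E' -> {in E' &, injective c} -> {in E', forall y, c y \in E} ->
  {in E, forall x, f (F x) = \sum_(y <- E' | le x (c y)) N y} ->
  {in E', forall y, f (M (c y)) = N y}.
Proof.
move=> uE' c_inj cE fF y Ey; rewrite (linear_monomial_pushforward cE fF) ?cE //.
rewrite -big_filter (_ : [seq _ <- E' | _] = [:: y]) ?big_seq1 //.
rewrite -(filter_pred1_uniq uE' Ey); apply: eq_in_filter => z Ez.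
exact: (inj_in_eq c_inj).
Qed.

End LinearOnMonomials.

(** * Free modules and tensor products *)

Section FreeModule.

Variables (R : nzRingType) (K : choiceType) (V : lmodType R).

HB.instance Definition _ (f : K -> V) :=
  GRing.isZmodMorphism.Build {freeg K / R} V (fglift f) (lift_is_additive f).

Lemma fglift_is_scalable (f : K -> V) : scalable (fglift f).
Proof.
move=> c D; rewrite -[D in RHS]freeg_sumE -[c *: D]/(fgscale c D) /fgscale !raddf_sum.
by apply: eq_bigr => x _ /=; rewrite !liftU scalerA.
Qed.

HB.instance Definition _ (f : K -> V) :=
  GRing.isScalable.Build R {freeg K / R} V *:%R (fglift f) (fglift_is_scalable f).

Lemma fglift_is_linear (f : K -> V) : linear (fglift f).
Proof. exact: linearP. Qed.

Lemma fglift1 (f : K -> V) x : fglift f << x >> = f x.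
Proof. by rewrite liftU scale1r. Qed.

Lemma freeg_sumZE (D : {freeg K / R}) : D = \sum_(x <- dom D) coeff x D *: << x >>.
Proof.
rewrite -[LHS]freeg_sumE; apply: eq_bigr => x _; apply/eqP/freeg_eqP => y.
by rewrite coeffZ !coeffU mul1r.
Qed.

Lemma freeg_linear_ext (f g : {linear {freeg K / R} -> V}) :
  (forall x, f << x >> = g << x >>) -> f =1 g.
Proof.
move=> eq_fg D; rewrite (freeg_sumZE D) !linear_sum; apply: eq_bigr => x _.
by rewrite !linearZ /= eq_fg.
Qed.

End FreeModule.

Section Tensor.

Variables K1 K2 : choiceType.

Lemma tens_is_bilinear : bilinear_for *:%R *:%R (@tens K1 K2).
Proof.
split=> [v|u] c x y; first exact: fglift_is_linear.
rewrite /tens [u]freeg_sumZE !linear_sum /= scaler_sumr -big_split /=.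
apply: eq_bigr => z _; rewrite !linearZ /= !fglift1 linearP /=.
by rewrite scalerDr !scalerA mulrC.
Qed.

HB.instance Definition _ := bilinear_isBilinear.Build rat {freeg K1 / rat}
  {freeg K2 / rat} {freeg (K1 * K2)%type / rat} *:%R *:%R (@tens K1 K2) tens_is_bilinear.

Lemma tens1 (x : K1) (y : K2) : tens << x >> << y >> = << (x, y) >>.
Proof. by rewrite /tens !fglift1. Qed.

Variables K3 K4 : choiceType.
Implicit Types (f : {freeg K1 / rat} -> {freeg K3 / rat}).
Implicit Types (g : {freeg K2 / rat} -> {freeg K4 / rat}).

HB.instance Definition _ f g := GRing.isLinear.Build rat
  {freeg (K1 * K2)%type / rat} _ _ (tmap f g) (fglift_is_linear _).

Lemma tmap1 f g p : tmap f g << p >> = tens (f << p.1 >>) (g << p.2 >>).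
Proof. exact: fglift1. Qed.

End Tensor.

Lemma tmap_tens (K1 K2 K3 K4 : choiceType)
    (f : {linear {freeg K1 / rat} -> {freeg K3 / rat}})
    (g : {linear {freeg K2 / rat} -> {freeg K4 / rat}}) u v :
  tmap f g (tens u v) = tens (f u) (g v).
Proof.
rewrite [u]freeg_sumZE [v]freeg_sumZE !linear_sumlz !linear_sum linear_sumlz.
apply: eq_bigr => x _; rewrite !linear_sumr linear_sum; apply: eq_bigr => y _.
by rewrite !linearZ /= !linearZl_LR /= !linearZ /= tens1 tmap1.
Qed.

Lemma eq_tmap (K1 K2 K3 K4 : choiceType)
    (f f' : {freeg K1 / rat} -> {freeg K3 / rat})
    (g g' : {freeg K2 / rat} -> {freeg K4 / rat}) :
  f =1 f' -> g =1 g' -> tmap f g =1 tmap f' g'.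
Proof.
by move=> eq_f eq_g; apply: freeg_linear_ext => p /=; rewrite !tmap1 eq_f eq_g.
Qed.

Lemma tmap_comp (K1 K2 K3 L1 L2 L3 : choiceType)
    (f : {freeg K1 / rat} -> {freeg K2 / rat})
    (f' : {linear {freeg K2 / rat} -> {freeg K3 / rat}})
    (g : {freeg L1 / rat} -> {freeg L2 / rat})
    (g' : {linear {freeg L2 / rat} -> {freeg L3 / rat}}) w :
  tmap f' g' (tmap f g w) = tmap (f' \o f) (g' \o g) w.
Proof.
move: w; apply: (freeg_linear_ext (f := tmap f' g' \o tmap f g)) => p /=.
by rewrite !tmap1 tmap_tens.
Qed.

(** * Splitting posets *)

Local Open Scope nat_scope.

(* The relation [code x] on positions is the set of noninversions of [x], so that [le]
   is its reverse inclusion; [op] places two such sets side by side, and [lpart p] and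
   [rpart p] restrict one to the positions before and after [p]. *)
Record splitting_poset (I : choiceType) (level : nat -> seq I) (code : I -> rel nat)
    (le : rel I) (op : I -> I -> I) (lpart rpart : nat -> I -> I) : Prop := {
  level_uniq n : uniq (level n);
  level_inj m n x : x \in level m -> x \in level n -> m = n;
  code_ltn n x : x \in level n -> forall i j, code x i j -> i < j < n;
  code_inj n : {in level n &, forall x y, code x =2 code y -> x = y};
  le_code n : {in level n &, forall x y, le x y <-> subrel (code y) (code x)};
  op_level m n a b : a \in level m -> b \in level n -> op a b \in level (m + n);
  code_op m n a b : a \in level m -> b \in level n -> forall i j,
    code (op a b) i j =
      if j < m then code a i j else (m <= i) && code b (i - m) (j - m);
  lpart_level m n x : x \in level (m + n) -> lpart m x \in level m;
  code_lpart m n x : x \in level (m + n) -> forall i j,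
    code (lpart m x) i j = (j < m) && code x i j;
  rpart_level m n x : x \in level (m + n) -> rpart m x \in level n;
  code_rpart m n x : x \in level (m + n) -> forall i j,
    code (rpart m x) i j = code x (m + i) (m + j) }.

Definition level_pairs (I : Type) (level : nat -> seq I) (n : nat) : seq (I * I) :=
  [seq ab | p <- iota 0 n.+1, ab <- [seq (a, b) | a <- level p, b <- level (n - p)]].

Lemma mem_level_pairs (I : eqType) (level : nat -> seq I) n a b :
  reflect (exists m p, [/\ m + p = n, a \in level m & b \in level p])
          ((a, b) \in level_pairs level n).
Proof.
apply: (iffP allpairsPdep) => [[p [ab [+ + def_ab]]]|[m [p [<- Ea Eb]]]].
  rewrite -def_ab mem_iota => lt_pn /allpairsP[[a' b'] /= [Ea Eb [-> ->]]].
  by exists p, (n - p); split=> //; lia.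
exists m, (a, b); split=> //; first by rewrite mem_iota; lia.
by apply/allpairsP; exists (a, b); rewrite addKn.
Qed.

Section SplittingPoset.

Variables (I : choiceType) (level : nat -> seq I) (code : I -> rel nat) (le : rel I).
Variables (op : I -> I -> I) (lpart rpart : nat -> I -> I).
Hypothesis sp : splitting_poset level code le op lpart rpart.

Lemma level_poset n : poset_on (level n) le.
Proof.
split=> [x Ex|x y Ex Ey /andP[]|y x z Ey Ex Ez]; first exact/(le_code sp Ex Ex).
  move=> /(le_code sp Ex Ey) le_xy /(le_code sp Ey Ex) le_yx.
  apply: (code_inj sp Ex Ey) => i j.
  by apply/idP/idP; [apply: le_yx|apply: le_xy].
move=> /(le_code sp Ex Ey) le_xy /(le_code sp Ey Ez) le_yz.
by apply/(le_code sp Ex Ez) => i j /le_yz/le_xy.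
Qed.

Lemma le_op m n x a b : x \in level (m + n) -> a \in level m -> b \in level n ->
  le x (op a b) = le (lpart m x) a && le (rpart m x) b.
Proof.
move=> Ex Ea Eb; have El := lpart_level sp Ex; have Er := rpart_level sp Ex.
apply/idP/andP => [/(le_code sp Ex (op_level sp Ea Eb)) le_x_ab|[]].
  split; [apply/(le_code sp El Ea)|apply/(le_code sp Er Eb)] => i j code_ij.
    have /andP[_ lt_jm] := code_ltn sp Ea code_ij.
    by rewrite (code_lpart sp Ex) lt_jm le_x_ab // (code_op sp Ea Eb) lt_jm.
  rewrite (code_rpart sp Ex) le_x_ab // (code_op sp Ea Eb).
  by rewrite ltnNge !leq_addr !addKn.
move=> /(le_code sp El Ea) le_l /(le_code sp Er Eb) le_r.
apply/(le_code sp Ex (op_level sp Ea Eb)) => i j.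
rewrite (code_op sp Ea Eb); case: ifP => [_ /le_l|/negbT + /andP[le_mi /le_r]].
  by rewrite (code_lpart sp Ex) => /andP[].
by rewrite (code_rpart sp Ex) -leqNgt => le_mj; rewrite !subnKC.
Qed.

Lemma op_parts m n x : x \in level (m + n) ->
  (forall i j, code x i j -> (j < m) || (m <= i)) -> op (lpart m x) (rpart m x) = x.
Proof.
move=> Ex not_across; have El := lpart_level sp Ex; have Er := rpart_level sp Ex.
apply: (code_inj sp _ Ex) => [|i j]; first exact: (op_level sp El Er).
rewrite (code_op sp El Er) (code_lpart sp Ex) (code_rpart sp Ex).
case: ltnP => // le_mj; rewrite (subnKC le_mj).
case: leqP => [/subnKC->//|lt_im]; apply/esym/negP => /not_across; lia.
Qed.

Lemma level_pairs_uniq n : uniq (level_pairs level n).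
Proof.
apply: allpairs_uniq_dep; first exact: iota_uniq.
  by move=> p _; apply: allpairs_uniq; rewrite ?(level_uniq sp) // => -[a b] [c d] _ _.
move=> _ _ /allpairsPdep[p [ab [_ + ->]]] /allpairsPdep[q [cd [_ + ->]]] /=.
move=> /allpairsP[[a b] [Ea _ ->]] /allpairsP[[c d] [Ec _ ->]] [eq_ac eq_bd] /=.
by rewrite -eq_ac -eq_bd in Ec *; rewrite (level_inj sp Ea Ec).
Qed.

Section MonomialBasis.

Local Open Scope ring_scope.

Variables (K : choiceType) (F M : I -> {freeg K / rat}).
Hypothesis FM : forall n, {in level n, F =1 upsum (level n) le M}.

Lemma coproduct_monomial n
    (Delta : {linear {freeg K / rat} -> {freeg (K * K)%type / rat}}) :
  {in level n, forall x,
    Delta (F x) = \sum_(p < n.+1) tens (F (lpart p x)) (F (rpart p x))} ->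
  {in level n, forall x,
    Delta (M x) =
    \sum_(ab <- level_pairs level n | op ab.1 ab.2 == x) tens (M ab.1) (M ab.2)}.
Proof.
move=> DeltaF.
apply: (linear_monomial_pushforward (level_uniq sp n) (level_poset n) (@FM n)
  (c := fun ab => op ab.1 ab.2) (N := fun ab => tens (M ab.1) (M ab.2))).
  by move=> [a b] /mem_level_pairs[m [p [<- Ea Eb]]]; apply: (op_level sp Ea Eb).
move=> x Ex; rewrite DeltaF // [RHS]big_mkcond [RHS]big_allpairs_dep /=.
rewrite -(big_mkord xpredT (fun p => tens (F (lpart p x)) (F (rpart p x)))).
apply: eq_big_seq => p; rewrite mem_iota => lt_pn.
have Enp : x \in level (p + (n - p)) by rewrite subnKC //; lia.
rewrite (FM (lpart_level sp Enp)) (FM (rpart_level sp Enp)).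
rewrite linear_sumlz big_allpairs /=.
rewrite big_mkcond; apply: eq_big_seq => a Ea.
rewrite linear_sumr big_mkcond /=.
case: ifP => le_a; last rewrite big1_seq //.
  by apply: eq_big_seq => b Eb; rewrite (le_op Enp Ea Eb) le_a.
by move=> b /andP[_ Eb]; rewrite (le_op Enp Ea Eb) le_a.
Qed.

Lemma counit_monomial n e (eps : {linear {freeg K / rat} -> rat^o}) :
  level 0 = [:: e] ->
  {in level n, forall x, eps (F x) = (n == 0%N)%:R} ->
  {in level n, forall x, eps (M x) = (n == 0%N)%:R}.
Proof.
move=> level0 epsF.
apply: (linear_monomial (level_uniq sp n) (level_poset n) (@FM n)) => x Ex /=.
rewrite epsF // /upsum; case: n {epsF} Ex => [|n] Ex; last by rewrite big1.
rewrite level0 mem_seq1 in Ex *; rewrite (eqP Ex) big_cons big_nil addr0.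
have [le_refl _ _] := level_poset 0.
by rewrite le_refl // level0 mem_head.
Qed.

End MonomialBasis.

End SplittingPoset.

(** * Trees and the Tamari order *)

(* Node [i] lies in the left subtree of node [j], where the nodes of [t] are numbered
   in-order from 0. *)
Fixpoint ldesc (t : tree) (i j : nat) : bool :=
  if t is Node l r then
    if j < tsize l then ldesc l i j
    else if j == tsize l then i < j
    else (tsize l < i) && ldesc r (i - (tsize l).+1) (j - (tsize l).+1)
  else false.

Lemma ldesc_ltn t i j : ldesc t i j -> i < j < tsize t.
Proof.
elim: t i j => //= l IHl r IHr i j.
by case: ltngtP => [_ /IHl||->]; [lia|move=> ? /andP[? /IHr]; lia|lia].
Qed.

Lemma ldesc_default t i j : tsize t <= j -> ldesc t i j = false.
Proof. by move=> le_tj; apply/negP => /ldesc_ltn; lia. Qed.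

Lemma ldesc_Noder l r i j :
  ldesc (Node l r) ((tsize l).+1 + i) ((tsize l).+1 + j) = ldesc r i j.
Proof. by rewrite /= !addKn addSnnS ltnNge leq_addr gtn_eqF /= -?addSnnS ?leq_addr. Qed.

Lemma ldesc_trans t : transitive (ldesc t).
Proof.
elim: t => //= l IHl r IHr j i k.
case: (ltngtP j (tsize l)) => [lt_jl|lt_lj|->] ld_ij;
  case: (ltngtP k (tsize l)) => lk //=.
- exact: IHl.
- by have := ldesc_ltn ld_ij; lia.
- by move/ldesc_ltn; lia.
- by move: ld_ij => /andP[-> ld_ij]; apply: IHr.
- by lia.
- by move/ldesc_ltn; lia.
Qed.

Lemma ldesc_between t i h j : ldesc t i j -> i <= h < j -> ldesc t h j.
Proof.
elim: t i h j => //= l IHl r IHr i h j.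
case: ltngtP => [_|lt_lj|_]; [exact: IHl| |lia].
by move=> /andP[lt_li /IHr ld_r] le_h; rewrite ld_r; lia.
Qed.

Lemma ldesc_inj s t : tsize s = tsize t -> ldesc s =2 ldesc t -> s = t.
Proof.
have leq_root l r l' r' : ldesc (Node l r) =2 ldesc (Node l' r') ->
    tsize l' < (tsize l + tsize r).+1 -> tsize l' <= tsize l.
  move=> eq_ld lt_l'; rewrite leqNgt; apply/negP => lt_ll'.
  have /= := eq_ld (tsize l) (tsize l').
  by case: ltngtP lt_ll'; rewrite ?ltnn ?eqxx; lia.
elim: s t => [|l IHl r IHr] [|l' r'] //= [eq_sz] eq_ld.
have eq_l : tsize l = tsize l'.
  have ge_l := leq_root l r l' r' eq_ld.
  have le_l : tsize l < (tsize l' + tsize r').+1 -> tsize l <= tsize l'.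
    by apply: leq_root => i j; apply/esym/eq_ld.
  lia.
have eq_r : tsize r = tsize r' by lia.
congr Node; [apply: IHl|apply: IHr] => // i j.
  have [lt_jl|le_lj] := ltnP j (tsize l); last by rewrite !ldesc_default // -eq_l.
  by have /= := eq_ld i j; rewrite -eq_l lt_jl.
by rewrite -(ldesc_Noder l r) -(ldesc_Noder l' r') -eq_l; apply: eq_ld.
Qed.

Lemma tsize_tbsl s t : tsize (tbsl s t) = tsize s + tsize t.
Proof. by elim: s => //= l _ r ->; lia. Qed.

Lemma ldesc_tbsl s t i j : ldesc (tbsl s t) i j =
  if j < tsize s then ldesc s i j
  else (tsize s <= i) && ldesc t (i - tsize s) (j - tsize s).
Proof.
elim: s i j => [|l _ r IHr] i j /=; first by rewrite !subn0.
case: ltngtP => [lt_jl|lt_lj|->]; first by rewrite (_ : j < _) //; lia.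
  rewrite IHr.
  have -> : (j - (tsize l).+1 < tsize r) = (j < (tsize l + tsize r).+1) by lia.
  case: ifP => // _; rewrite andbA -!subnDA addSn; congr (_ && _); lia.
by rewrite ltnS leq_addr.
Qed.

Fixpoint tsplit (p : nat) (t : tree) : tree * tree :=
  if t is Node l r then
    if p <= tsize l then ((tsplit p l).1, Node (tsplit p l).2 r)
    else (Node l (tsplit (p - (tsize l).+1) r).1, (tsplit (p - (tsize l).+1) r).2)
  else (Leaf, Leaf).

Definition tsplitl (p : nat) (t : tree) : tree := (tsplit p t).1.
Definition tsplitr (p : nat) (t : tree) : tree := (tsplit p t).2.

Lemma tsize_tsplitl p t : p <= tsize t -> tsize (tsplitl p t) = p.
Proof.
rewrite /tsplitl; elim: t p => [|l IHl r IHr] p /=; first by case: p.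
by case: (leqP p (tsize l)) => [le_pl|lt_lp] le_pt /=; rewrite ?IHl ?IHr; lia.
Qed.

Lemma tsize_tsplitr p t : p <= tsize t -> tsize (tsplitr p t) = tsize t - p.
Proof.
rewrite /tsplitr; elim: t p => [|l IHl r IHr] p //=.
by case: (leqP p (tsize l)) => [le_pl|lt_lp] le_pt /=; rewrite ?IHl ?IHr; lia.
Qed.

Lemma ldesc_tsplitl p t i j : p <= tsize t ->
  ldesc (tsplitl p t) i j = (j < p) && ldesc t i j.
Proof.
rewrite /tsplitl; elim: t p i j => [|l IHl r IHr] p i j /=; first by rewrite andbF.
case: (leqP p (tsize l)) => [le_pl|lt_lp] le_pt /=; first rewrite IHl //.
  by case: ltnP => //= lt_jp; rewrite (leq_trans lt_jp).
case: ltngtP => [lt_jl||->]; [|move=> lt_lj|]; rewrite ?lt_lp ?(ltn_trans lt_jl) //.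
by rewrite IHr ?leq_subLR // andbCA ltn_sub2rE.
Qed.

Lemma ldesc_tsplitr p t i j : p <= tsize t ->
  ldesc (tsplitr p t) i j = ldesc t (p + i) (p + j).
Proof.
rewrite /tsplitr; elim: t p i j => [|l IHl r IHr] p i j //=.
case: (leqP p (tsize l)) => [le_pl|lt_lp] le_pt /=.
  rewrite (tsize_tsplitr le_pl) ltn_subRL -(eqn_add2l p) subnKC // IHl //.
  case: ltngtP => _; [by []| |by rewrite ltn_add2l].
  by congr (_ && ldesc r _ _); lia.
by rewrite IHr ?leq_subLR // -(ldesc_Noder l) !addnA !subnKC.
Qed.

Lemma tsplit_tbsl a b : tsplit (tsize a) (tbsl a b) = (a, b).
Proof.
elim: a => [|l _ r IHr] /=; first by elim: b => //= l -> r _.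
by rewrite ltnNge leq_addr /= subSS addKn IHr.
Qed.

Definition tam_le (s t : tree) : bool :=
  [forall i : 'I_(tsize t), forall j : 'I_(tsize t), ldesc t i j ==> ldesc s i j].

Lemma tam_leP s t : reflect (subrel (ldesc t) (ldesc s)) (tam_le s t).
Proof.
apply: (iffP 'forall_'forall_implyP) => [le_st i j ld_ij|le_st i j]; last exact: le_st.
have [lt_it lt_jt] : i < tsize t /\ j < tsize t by have := ldesc_ltn ld_ij; lia.
exact: (le_st (Ordinal lt_it) (Ordinal lt_jt)).
Qed.

Lemma mem_treesn n t : (t \in treesn n) = (tsize t == n).
Proof.
rewrite mem_filter andb_idr // => /eqP<-{n}.
suff mem_trees_h k : tsize t <= k -> t \in trees_h k by apply: mem_trees_h.
elim: t k => [|l IHl r IHr] [|k] //= le_k; rewrite inE.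
apply/mapP; exists (l, r) => //; apply/allpairsP; exists (l, r).
by split; rewrite ?IHl ?IHr //=; lia.
Qed.

Lemma mem_treesn_tsize t : t \in treesn (tsize t).
Proof. by rewrite mem_treesn. Qed.

Lemma treesn_uniq n : uniq (treesn n).
Proof.
apply: filter_uniq; elim: n => //= n IHn; rewrite map_inj_uniq; last first.
  by move=> [a b] [c d] [-> ->].
apply/andP; split; first by apply/mapP => -[].
by apply: allpairs_uniq => // -[a b] [c d] _ _ [-> ->].
Qed.

Lemma tamari_splitting : splitting_poset treesn ldesc tam_le tbsl tsplitl tsplitr.
Proof.
have le_mt m n t : t \in treesn (m + n) -> m <= tsize t.
  by rewrite mem_treesn => /eqP->; apply: leq_addr.
split.
- exact: treesn_uniq.
- by move=> m n t; rewrite !mem_treesn => /eqP-> /eqP.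
- by move=> n t; rewrite mem_treesn => /eqP<-; apply: ldesc_ltn.
- by move=> n s t; rewrite !mem_treesn => /eqP<- /eqP/esym; apply: ldesc_inj.
- by move=> n s t _ _; split=> /tam_leP.
- by move=> m n a b; rewrite !mem_treesn tsize_tbsl => /eqP-> /eqP->.
- by move=> m n a b; rewrite !mem_treesn => /eqP<- _ i j; apply: ldesc_tbsl.
- by move=> m n t /le_mt le_t; rewrite mem_treesn tsize_tsplitl.
- by move=> m n t /le_mt le_t i j; apply: ldesc_tsplitl.
- move=> m n t Et; rewrite mem_treesn tsize_tsplitr ?(le_mt _ _ _ Et) //.
  by move: Et; rewrite mem_treesn => /eqP->; rewrite addKn.
by move=> m n t /le_mt le_t i j; apply: ldesc_tsplitr.
Qed.

Definition rotation (s t : tree) : Prop := t \in rots s.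
Local Notation rotations := (clos_refl_trans tree rotation).

Lemma rotations_Node l l' r r' :
  rotations l l' -> rotations r r' -> rotations (Node l r) (Node l' r').
Proof.
move=> rot_l rot_r; apply: (@rt_trans _ _ _ (Node l' r)).
  elim: rot_l => [a b ab|a|a b c _ ab _ bc]; [apply: rt_step|apply: rt_refl|].
    by rewrite /rotation /= !mem_cat (map_f (Node ^~ r)) // orbT.
  exact: rt_trans ab bc.
elim: rot_r => [a b ab|a|a b c _ ab _ bc]; [apply: rt_step|apply: rt_refl|].
  by rewrite /rotation /= !mem_cat (map_f (Node l')) // !orbT.
exact: rt_trans ab bc.
Qed.

Lemma rotations_tbsl_Node a b c : rotations (Node (tbsl a b) c) (tbsl a (Node b c)).
Proof.
elim: a => [|l _ r IHr]; first exact: rt_refl.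
apply: (@rt_trans _ _ _ (Node l (Node (tbsl r b) c))).
  by apply: rt_step; rewrite /rotation /= inE eqxx.
exact: rotations_Node (rt_refl _ _ _) IHr.
Qed.

Lemma rotations_tsplit p t : rotations t (tbsl (tsplitl p t) (tsplitr p t)).
Proof.
rewrite /tsplitl /tsplitr; elim: t p => [|l IHl r IHr] p /=; first exact: rt_refl.
case: ifP => _ /=; last exact: rotations_Node (rt_refl _ _ _) (IHr _).
apply: rt_trans (rotations_tbsl_Node _ _ _).
exact: rotations_Node (IHl p) (rt_refl _ _ _).
Qed.

Lemma rotation_tsize s t : rotation s t -> tsize t = tsize s.
Proof.
rewrite /rotation; elim: s t => [|l IHl r IHr] t //=.
rewrite !mem_cat => /or3P[|/mapP[l' /IHl eq_l ->]|/mapP[r' /IHr eq_r ->]] /=; try lia.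
by case: l {IHl} => //= a b; rewrite inE => /eqP->; rewrite /=; lia.
Qed.

Lemma tam_le_tbsl t a b : tsize t = tsize a + tsize b ->
  tam_le t (tbsl a b) =
  tam_le (tsplitl (tsize a) t) a && tam_le (tsplitr (tsize a) t) b.
Proof. by move=> sz_t; apply: (le_op tamari_splitting); rewrite mem_treesn ?sz_t. Qed.

Lemma rotation_tam_le s t : rotation s t -> tam_le s t.
Proof.
rewrite /rotation; elim: s t => [|l IHl r IHr] t //=.
rewrite !mem_cat => /or3P[|/mapP[l' rot_l ->]|/mapP[r' rot_r ->]].
- case: l {IHl} => //= a b; rewrite inE => /eqP->.
  rewrite -[Node a (Node b r)]/(tbsl (Node a Leaf) (Node b r)).
  rewrite tam_le_tbsl /=; last by lia.
  rewrite /tsplitl /tsplitr /= addn0 ltnS leq_addr ltnn subnn /=.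
  by rewrite (tsplit_tbsl Leaf); apply/andP; split; apply/tam_leP.
- have /tam_leP le_l := IHl _ rot_l; apply/tam_leP => i j /=.
  by rewrite (rotation_tsize rot_l); case: ifP => // _; apply: le_l.
have /tam_leP le_r := IHr _ rot_r; apply/tam_leP => i j /=.
by do 2 case: ifP => // _; move=> /andP[-> /le_r].
Qed.

Lemma tam_le_Node_Leaf t l : tsize t = (tsize l).+1 -> tam_le t (Node l Leaf) ->
  exists2 a, t = Node a Leaf & tam_le a l.
Proof.
case: t => //= a b [sz_ab] /tam_leP le_t; have sz_b : tsize b = 0.
  apply/eqP; rewrite -leqn0 leqNgt; apply/negP => b_gt0.
  have /= := le_t (tsize a) (tsize l); rewrite ltnn eqxx -sz_ab.
  rewrite -{1}(addn0 (tsize a)) ltn_add2l b_gt0 ltnNge leq_addr.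
  by rewrite gtn_eqF /= ?ltnn; lia.
have eq_al : tsize a = tsize l by lia.
case: b sz_b {sz_ab} le_t => // _ le_t; exists a => //; apply/tam_leP => i j ld_ij.
have /andP[_ lt_jl] := ldesc_ltn ld_ij.
by have /= := le_t i j; rewrite eq_al lt_jl; apply.
Qed.

(* First rotate [t] to [tsplitl p t \ tsplitr p t], where [p] cuts [s] after its root. *)
Lemma tam_le_rotations t s : tsize t = tsize s -> tam_le t s -> rotations t s.
Proof.
elim: s t => [|l IHl r IHr] t /= sz_t le_t.
  by case: t sz_t le_t => // *; apply: rt_refl.
have le_pt : (tsize l).+1 <= tsize t by lia.
have := le_t; rewrite -[Node l r]/(tbsl (Node l Leaf) r) tam_le_tbsl /= ?addn0 ?sz_t //.
case/andP=> /tam_le_Node_Leaf[|a eq_a le_al le_r]; first by rewrite tsize_tsplitl.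
have sz_a : tsize a = tsize l by have := tsize_tsplitl le_pt; rewrite eq_a /=; lia.
have rot_r : rotations (tsplitr (tsize l).+1 t) r.
  by apply: IHr le_r; rewrite tsize_tsplitr; lia.
apply: rt_trans (rotations_tsplit (tsize l).+1 t) _; rewrite eq_a.
exact: rotations_Node (IHl a sz_a le_al) rot_r.
Qed.

Lemma tam_leNE n : @tam_leN n =2 relpre val tam_le.
Proof.
move=> a b /=; have tsize_val (u : TreeN n) : tsize (val u) = n.
  by apply/eqP; rewrite -mem_treesn; apply: (valP u).
apply/idP/idP => [/connectP[p]|].
  elim: p a => [a _ ->|c p IHp a /= /andP[/rotation_tam_le/tam_leP le_ac path_p] eq_b].
    exact/tam_leP.
  by have /tam_leP le_cb := IHp c path_p eq_b; apply/tam_leP => i j /le_cb/le_ac.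
move/(tam_le_rotations (etrans (tsize_val a) (esym (tsize_val b)))).
have connect_rotations s t : rotations s t -> forall u : TreeN n, val u = s ->
    exists2 v : TreeN n, val v = t & tam_leN u v.
  elim=> {s t} [s t rot_st|s|s t w _ st _ tw] u def_u.
  - have Et : t \in treesn n.
      by rewrite mem_treesn (rotation_tsize rot_st) -def_u tsize_val.
    by exists (SeqSub Et) => //; apply: connect1; rewrite def_u.
  - by exists u => //; apply: connect0.
  have [v def_v uv] := st u def_u; have [x def_x vx] := tw v def_v.
  by exists x => //; apply: connect_trans uv vx.
by move=> /connect_rotations-/(_ a erefl)[v /val_inj->].
Qed.

Lemma splitsE t : splits t = [seq tsplit p t | p <- iota 0 (tsize t).+1].
Proof.
elim: t => // l IHl r IHr; rewrite [splits _]/= IHl IHr -!map_comp.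
have -> : (tsize (Node l r)).+1 = (tsize l).+1 + (tsize r).+1 by rewrite /= addnS.
rewrite iotaD map_cat; congr (_ ++ _).
  by apply/eq_in_map => p; rewrite mem_iota /= ltnS => ->.
rewrite -[0 + _]addn0 add0n iotaDl -map_comp; apply/eq_in_map => p _ /=.
by rewrite addSn ltnNge leq_addr subSS addKn.
Qed.

Fixpoint cuts (t : tree) : seq (tree * tree) :=
  (Leaf, t) ::
  (if t is Node l r then [seq (Node l ab.1, ab.2) | ab <- cuts r] else [::]).

Lemma mem_cuts t a b : ((a, b) \in cuts t) = (tbsl a b == t).
Proof.
elim: t a b => [|l _ r IHr] [|al ar] b /=;
  rewrite inE xpair_eqE /= ?orbF ?(eq_sym b) //.
  by case: mapP => [[ab _ //]|_]; rewrite orbF.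
apply/mapP/eqP => [[[x y] + [-> -> ->]]|[-> eq_r]]; first by rewrite IHr => /eqP->.
by exists (ar, b); rewrite ?IHr ?eq_r.
Qed.

Lemma cuts_uniq t : uniq (cuts t).
Proof.
elim: t => //= l _ r IHr; rewrite map_inj_uniq ?IHr ?andbT => [|[a b] [c d] [-> ->] //].
by apply/mapP => -[].
Qed.

(** * Compositions and leaf sets *)

Lemma size_leaf_flags t b : size (leaf_flags t b) = (tsize t).+1.
Proof. by elim: t b => //= l IHl r IHr b; rewrite size_cat IHl IHr addnS. Qed.

Lemma nth_leaf_flags t b i : nth false (leaf_flags t b) i =
  if i < tsize t then (0 < i) ==> ~~ ldesc t i.-1 i
  else [&& i == tsize t, t == Leaf & b].
Proof.
elim: t b i => [|l IHl r IHr] b i; first by case: i => //= i; rewrite nth_nil.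
rewrite [leaf_flags _ _]/= nth_cat size_leaf_flags ltnS IHl.
case: (ltngtP i (tsize l)) => [lt_il|lt_li|->] /=.
- by rewrite lt_il (ltn_trans lt_il) ?ltnS ?leq_addr.
- case: i lt_li => // i; rewrite ltnS => le_li.
  rewrite subSS IHr /= ltnS ltn_subLR // !andbF.
  rewrite [i.+1 < tsize l]ltnNge leqW // gtn_eqF //= -subnS subn_gt0 negb_and.
  by rewrite implybE.
by rewrite ltnS leq_addr ltnn eqxx; case: (l) => //= *; rewrite ltnSn.
Qed.

Lemma LsetE t : Lset t = [seq i <- iota 1 (tsize t).-1 | ~~ ldesc t i.-1 i].
Proof.
apply: eq_in_filter => i; rewrite mem_iota => /andP[i_gt0 lt_it].
by rewrite nth_leaf_flags i_gt0 ifT //; lia.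
Qed.

Lemma mem_Lset t i : (i \in Lset t) = (0 < i < tsize t) && ~~ ldesc t i.-1 i.
Proof. by rewrite LsetE mem_filter mem_iota andbC; congr (_ && _); lia. Qed.

Lemma Lset_tbsl s t : 0 < tsize s -> 0 < tsize t ->
  Lset (tbsl s t) = Lset s ++ tsize s :: [seq tsize s + i | i <- Lset t].
Proof.
move=> s_gt0 t_gt0; rewrite !LsetE tsize_tbsl.
have -> : (tsize s + tsize t).-1 = (tsize s).-1 + (1 + (tsize t).-1) by lia.
rewrite !iotaD !filter_cat add1n prednK //; congr (_ ++ _).
  apply: eq_in_filter => i; rewrite mem_iota => lt_is.
  by rewrite ldesc_tbsl ifT //; lia.
rewrite /= ldesc_tbsl ltnn leqNgt prednK // leqnn /= -addn1 iotaDl filter_map.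
congr (_ :: map _ _); apply: eq_in_filter => i; rewrite mem_iota; case: i => // i _.
by rewrite /= ldesc_tbsl ltnNge leq_addr addKn addnS /= leq_addr addKn.
Qed.

Lemma tsize_lcomb n : tsize (lcomb n) = n.
Proof. by elim: n => //= n ->; rewrite addn0. Qed.

Lemma ldesc_lcomb n i j : ldesc (lcomb n) i j = (i < j < n).
Proof.
elim: n => [|n IHn] /=; first by rewrite andbF.
by rewrite tsize_lcomb IHn andbF; case: ltngtP => //; lia.
Qed.

Lemma Lset_lcomb n : Lset (lcomb n) = [::].
Proof.
rewrite LsetE tsize_lcomb -(filter_pred0 (iota 1 n.-1)); apply: eq_in_filter => i.
by rewrite mem_iota ldesc_lcomb /=; lia.
Qed.

Lemma tbsl_Leaf t : tbsl t Leaf = t.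
Proof. by elim: t => //= l _ r ->. Qed.

Lemma tsize_Cmap c : tsize (Cmap c) = sumn c.
Proof. by elim: c => //= a c <-; rewrite tsize_tbsl tsize_lcomb. Qed.

Lemma comp_sumn_gt0 c : is_comp c -> (0 < sumn c) = (c != [::]).
Proof. by case: c => //= a c /andP[a_gt0 _]; rewrite addn_gt0 a_gt0. Qed.

Lemma Lset_Cmap_cons a c : is_comp (a :: c) -> c != [::] ->
  Lset (Cmap (a :: c)) = a :: [seq a + i | i <- Lset (Cmap c)].
Proof.
move=> /andP[a_gt0 c_comp] c_neq0.
by rewrite [Cmap _]/= Lset_tbsl ?tsize_lcomb ?tsize_Cmap ?comp_sumn_gt0 // Lset_lcomb.
Qed.

Lemma cuts_Cmap c : is_comp c ->
  cuts (Cmap c) = [seq (Cmap (take i c), Cmap (drop i c)) | i <- iota 0 (size c).+1].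
Proof.
elim: c => //= -[|a] c IHc //= c_comp; rewrite -/(Cmap c) IHc //; congr (_ :: _).
rewrite -[_ :: map _ _]/(map _ (iota 0 (size c).+1)) -map_comp.
by rewrite /= -[2]/(1 + 1) (iotaDl 1 1) -map_comp.
Qed.

Local Notation gaps := (pairmap (fun i j => j - i)).

Lemma gaps_addn a i s : gaps (a + i) [seq a + j | j <- s] = gaps i s.
Proof. by elim: s i => //= j s IHs i; rewrite IHs subnDl. Qed.

Lemma comp_of_set_Lset c : is_comp c -> comp_of_set (sumn c) (Lset (Cmap c)) = c.
Proof.
have [-> // | c_neq0] := eqVneq c [::]; move=> c_comp.
rewrite /comp_of_set gtn_eqF ?comp_sumn_gt0 //.
elim: c c_neq0 c_comp => // a c IHc _ ac_comp.
have [-> | c_neq0] := eqVneq c [::].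
  by rewrite /Cmap /= tbsl_Leaf Lset_lcomb /= subn0 addn0.
have [_ c_comp] := andP ac_comp.
rewrite Lset_Cmap_cons //= subn0 -map_rcons -[in RHS](IHc c_neq0 c_comp).
by rewrite -(gaps_addn a 0) addn0.
Qed.

Lemma gaps_spec n i s (c := gaps i (rcons s n)) : path ltn i (rcons s n) ->
  [/\ is_comp c, sumn c = n - i & [seq i + j | j <- Lset (Cmap c)] = s].
Proof.
rewrite {}/c; elim: s i => [|j s IHs] i /=.
  by rewrite /Cmap /= andbT tbsl_Leaf Lset_lcomb /is_comp /= andbT addn0 subn_gt0.
case/andP=> lt_ij path_s; have [s_comp sum_s Lset_s] := IHs j path_s.
have lt_jn : j < n.
  by have /allP := order_path_min ltn_trans path_s; apply; rewrite mem_rcons mem_head.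
split; first by rewrite /is_comp /= subn_gt0 lt_ij.
  by rewrite sum_s; lia.
rewrite Lset_Cmap_cons.
- rewrite /= subnKC ?(ltnW lt_ij) // -map_comp -[in RHS]Lset_s; congr (_ :: _).
  by apply: eq_map => k /=; rewrite addnA subnKC // ltnW.
- by rewrite /is_comp /= subn_gt0 lt_ij.
by case: (s).
Qed.

Lemma mem_subseqs s t : (t \in subseqs s) = subseq t s.
Proof.
elim: s t => [|x s IHs] [|y t] //=; rewrite mem_cat IHs ?sub0seq ?orbT //.
case: eqP => [<-|ne_yx]; last by case: mapP => // -[u _ [/ne_yx]].
rewrite (mem_map (f := cons y)) => [|u v [] //]; rewrite IHs orb_idr //.
exact/subseq_trans/subseq_cons.
Qed.

Lemma subseqs_uniq s : uniq s -> uniq (subseqs s).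
Proof.
elim: s => //= x s IHs /andP[s'x us].
rewrite cat_uniq map_inj_uniq ?IHs //= => [|u v []//].
rewrite andbT; apply/hasPn => u; rewrite mem_subseqs => sub_us.
apply: contra s'x => /mapP[v _ def_u]; apply: (mem_subseq sub_us).
by rewrite def_u mem_head.
Qed.

Lemma comp_of_set_spec n T (c := comp_of_set n T) : T \in subseqs (iota 1 n.-1) ->
  [/\ is_comp c, sumn c = n & Lset (Cmap c) = T].
Proof.
rewrite {}/c /comp_of_set mem_subseqs; case: n => [|n] /= sub_T; first by case: T sub_T.
have path_T : path ltn 0 (rcons T n.+1).
  have: path ltn 0 (rcons (iota 1 n) n.+1).
    by rewrite -cats1 -(iotaD 1 n 1); apply: (iota_ltn_sorted 0 (n + 1).+1).
  by apply: subseq_path; [apply: ltn_trans|rewrite -!cats1; apply: cat_subseq].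
have [c_comp -> Lset_T] := gaps_spec path_T.
by split; rewrite ?subn0 // -[RHS]Lset_T map_id.
Qed.

Lemma ldesc_Cmap_succ c i j k :
  ldesc (Cmap c) i j -> i < k <= j -> ldesc (Cmap c) k.-1 k.
Proof.
elim: c i j k => //= a c IHc i j k; rewrite -/(Cmap c) !ldesc_tbsl tsize_lcomb.
rewrite !ldesc_lcomb; case: ltnP => [lt_ja|le_aj] ld_ij le_k; first by case: ltnP; lia.
have [le_ai ld_c] := andP ld_ij; rewrite ifF; last by lia.
by rewrite -predn_sub (IHc _ _ (k - a) ld_c) ?andbT; lia.
Qed.

Lemma tam_le_Cmap t c : tsize t = sumn c ->
  tam_le t (Cmap c) = all (fun i => i \in Lset (Cmap c)) (Lset t).
Proof.
move=> sz_t; apply/tam_leP/allP => [le_t i|sub_L i j ld_ij].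
  rewrite !mem_Lset tsize_Cmap sz_t => /andP[->]; apply: contra; apply: le_t.
have ld_succ k : i < k <= j -> ldesc t k.-1 k.
  move=> le_k; have ld_k := ldesc_Cmap_succ ld_ij le_k.
  apply: contraTT ld_k => nld_k; have := sub_L k; rewrite !mem_Lset nld_k andbT.
  have := ldesc_ltn ld_ij; rewrite tsize_Cmap -sz_t => lt_j.
  by case/(_ _)/andP => //; lia.
have /andP[lt_ij _] := ldesc_ltn ld_ij.
apply: (@homo_ltn_in _ [pred k | i <= k <= j] id (ldesc t)) => [|x y|k|||//];
  rewrite ?inE ?leqnn ?andbT ?(ltnW lt_ij) //.
- exact: ldesc_trans.
- by move=> le_x le_y z; rewrite inE; lia.
by move=> le_k le_k1; apply: (ld_succ k.+1); lia.
Qed.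

(** * Permutations and the weak order *)

Definition noninv (s : seq nat) (i j : nat) : bool :=
  (i < j < size s) && (nth 0 s i < nth 0 s j).

Lemma mem_permsn n s : (s \in permsn n) = is_perm s && (size s == n).
Proof.
rewrite mem_permutations /is_perm; apply/idP/andP => [perm_s|[perm_s /eqP<-//]].
have sz_s : size s = n by rewrite (perm_size perm_s) size_iota.
by rewrite sz_s eqxx.
Qed.

Lemma mem_permsn_size s : (s \in permsn (size s)) = is_perm s.
Proof. by rewrite mem_permsn eqxx andbT. Qed.

Lemma is_perm_uniq s : is_perm s -> uniq s.
Proof. by move/perm_uniq->; apply: iota_uniq. Qed.

Lemma is_perm_nth s i : is_perm s -> i < size s -> 0 < nth 0 s i <= size s.
Proof. by move=> perm_s /(mem_nth 0); rewrite (perm_mem perm_s) mem_iota. Qed.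

Lemma size_st s : size (st s) = size s.
Proof. exact: size_map. Qed.

Lemma count_ltn_mono s x y : x \in s ->
  (count (fun z => z < x) s < count (fun z => z < y) s) = (x < y).
Proof.
move=> sx; have [lt_xy|le_yx] := ltnP x y; last first.
  by apply/negbTE; rewrite -leqNgt; apply: sub_count => z /= /leq_trans; apply.
have/(_ s) := @count_predUI _ (fun z => z < x) (pred1 x).
rewrite [X in _ + X](@eq_count _ _ pred0) => [|z]; last by rewrite /=; lia.
rewrite count_pred0 addn0 -addn1 => cnt.
apply: leq_trans (_ : _ <= count (predU (fun z => z < x) (pred1 x)) s) _.
  by rewrite cnt leq_add2l -has_count has_pred1.
by apply: sub_count => z /=; lia.
Qed.

Lemma st_ltn s i j : i < size s -> j < size s ->
  (nth 0 (st s) i < nth 0 (st s) j) = (nth 0 s i < nth 0 s j).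
Proof.
by move=> lt_i lt_j; rewrite !(nth_map 0) // ltnS count_ltn_mono // mem_nth.
Qed.

Lemma is_perm_st (s : seq nat) : uniq s -> is_perm (st s).
Proof.
move=> us; have ust : uniq (st s).
  apply/(uniqP 0) => i j; rewrite !inE size_st => lt_i lt_j eq_ij; apply/eqP.
  rewrite -(nth_uniq 0 lt_i lt_j us).
  by move: (st_ltn lt_i lt_j) (st_ltn lt_j lt_i); rewrite eq_ij ltnn; case: ltngtP.
rewrite /is_perm size_st; have sub_iota : {subset st s <= iota 1 (size s)}.
  move=> _ /mapP[x sx ->]; rewrite mem_iota /= add1n ltnS ltn_neqAle count_size andbT.
  by rewrite -all_count; apply/allPn; exists x; rewrite ?ltnn.
have [|_ eq_mem] := uniq_min_size ust sub_iota; first by rewrite size_iota size_st.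
exact: uniq_perm (iota_uniq _ _) eq_mem.
Qed.

Lemma noninv_st s : noninv (st s) =2 noninv s.
Proof.
move=> i j; rewrite /noninv size_st; case: (boolP (i < j < _)) => //= /andP[lt_ij lt_j].
by rewrite st_ltn // (ltn_trans lt_ij).
Qed.

Lemma noninv_inj s t : is_perm s -> is_perm t -> size s = size t ->
  noninv s =2 noninv t -> s = t.
Proof.
move=> perm_s perm_t eq_sz eq_ni.
have count_iota x m n : count (fun y => y < x) (iota m n) = minn n (x - m).
  by elim: n m => [|n IHn] m /=; rewrite ?min0n // IHn; case: ltnP; lia.
have nthE u i : is_perm u -> i < size u ->
    nth 0 u i = (count (fun j => nth 0 u j < nth 0 u i) (iota 0 (size u))).+1.
  move=> perm_u lt_i; have := is_perm_nth perm_u lt_i.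
  transitivity (count (fun y => y < nth 0 u i) u).+1.
    by rewrite (permP perm_u) count_iota; lia.
  by rewrite -[X in count _ X](mkseq_nth 0 u) count_map.
have ltE u i j : is_perm u -> i < size u -> j < size u ->
    (nth 0 u j < nth 0 u i) = noninv u j i || ((i < j) && ~~ noninv u i j).
  move=> /is_perm_uniq uu lt_i lt_j; rewrite /noninv lt_i lt_j.
  case: (ltngtP i j) => /= [lt_ij|lt_ji|->]; [|by rewrite orbF|by rewrite ltnn].
  by rewrite -leqNgt ltn_neqAle nth_uniq // gtn_eqF.
apply: (@eq_from_nth _ 0) => // i lt_i.
rewrite (nthE s) // (nthE t) -?eq_sz //; congr _.+1.
apply: eq_in_count => j; rewrite mem_iota => /andP[_ lt_j].
by rewrite !ltE -?eq_sz // !eq_ni.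
Qed.

Lemma mem_inversions s i j :
  ((i, j) \in inversions s) = (i < j < size s) && (nth 0 s j < nth 0 s i).
Proof.
rewrite mem_filter /= (_ : (i, j) \in _ = (i < size s) && (j < size s)).
  by case: (nth 0 s j < _); lia.
apply/allpairsP/andP => [[[a b] /= []]|[lt_i lt_j]].
  by rewrite !mem_iota => lt_a lt_b [-> ->].
by exists (i, j); rewrite !mem_iota.
Qed.

Lemma weak_leP s t : uniq s -> uniq t -> size s = size t ->
  reflect (subrel (noninv t) (noninv s)) (weak_le s t).
Proof.
move=> us ut eq_sz.
have inv_noninv u i j : uniq u -> i < j < size u ->
    ((i, j) \in inversions u) = ~~ noninv u i j.
  move=> uu lt_ij; rewrite mem_inversions /noninv lt_ij /= -leqNgt ltn_neqAle.
  by rewrite nth_uniq //; lia.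
apply: (iffP allP) => [le_st i j ni_t|ni_ts [i j]].
  have /andP[lt_ij _] := ni_t; have lt_ijs := lt_ij; rewrite -eq_sz in lt_ijs.
  by apply: contraLR ni_t; rewrite -!inv_noninv //; apply: le_st.
move=> inv_s; have := inv_s; rewrite mem_inversions => /andP[lt_ij _].
have lt_ijt := lt_ij; rewrite eq_sz in lt_ijt.
by move: inv_s; rewrite !inv_noninv //; apply: contra; apply: ni_ts.
Qed.

Lemma size_pbsl u v : size (pbsl u v) = size u + size v.
Proof. by rewrite size_cat size_map. Qed.

Lemma nth_pbsl u v i : nth 0 (pbsl u v) i =
  if i < size u then nth 0 u i + size v else nth 0 v (i - size u).
Proof. by rewrite nth_cat size_map; case: ltnP => // lt_i; rewrite (nth_map 0). Qed.

Lemma pbsl_inj u v u' v' : size u = size u' -> size v = size v' ->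
  pbsl u v = pbsl u' v' -> (u, v) = (u', v').
Proof.
move=> eq_u eq_v /eqP; rewrite eqseq_cat ?size_map // eq_v => /andP[/eqP eq_map /eqP->].
by rewrite (inj_map (@addIn _) eq_map).
Qed.

Lemma is_perm_pbsl u v : is_perm u -> is_perm v -> is_perm (pbsl u v).
Proof.
move=> perm_u perm_v; rewrite /is_perm size_pbsl addnC iotaD perm_catC addnC iotaDl.
by apply: perm_cat => //; rewrite (eq_map (addnC^~ _)); apply: perm_map.
Qed.

Lemma noninv_pbsl u v i j : is_perm u -> is_perm v -> noninv (pbsl u v) i j =
  if j < size u then noninv u i j
  else (size u <= i) && noninv v (i - size u) (j - size u).
Proof.
move=> perm_u perm_v; rewrite /noninv size_pbsl !nth_pbsl.
case: (ltnP j (size u)) => [lt_ju|le_uj].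
  have [lt_iu|le_ui] := ltnP i (size u); last by lia.
  by rewrite ltn_add2r; lia.
have [lt_iu|le_ui] /= := ltnP i (size u).
  by have := is_perm_nth perm_u lt_iu; have := @is_perm_nth v (j - size u) perm_v; lia.
by congr (_ && _); lia.
Qed.

Lemma weak_splitting :
  splitting_poset permsn noninv weak_le pbsl
    (fun p s => st (take p s)) (fun p s => st (drop p s)).
Proof.
have size_takeD m n (s : seq nat) : size s = m + n -> size (take m s) = m.
  by move=> sz_s; rewrite size_takel // sz_s leq_addr.
split.
- by move=> n; apply: permutations_uniq.
- by move=> m n s; rewrite !mem_permsn => /andP[_ /eqP->] /andP[_ /eqP].
- by move=> n s; rewrite mem_permsn => /andP[_ /eqP<-] i j /andP[].
- move=> n s t; rewrite !mem_permsn => /andP[perm_s /eqP<-] /andP[perm_t /eqP/esym].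
  exact: noninv_inj.
- move=> n s t; rewrite !mem_permsn.
  move=> /andP[perm_s /eqP<-] /andP[perm_t /eqP/esym eq_sz].
  have le_stP := weak_leP (is_perm_uniq perm_s) (is_perm_uniq perm_t) eq_sz.
  by split=> /le_stP.
- move=> m n u v; rewrite !mem_permsn size_pbsl.
  move=> /andP[perm_u /eqP->] /andP[perm_v /eqP->].
  by rewrite is_perm_pbsl // eqxx.
- move=> m n u v; rewrite !mem_permsn => /andP[perm_u /eqP<-] /andP[perm_v _] i j.
  exact: noninv_pbsl.
- move=> m n s; rewrite !mem_permsn size_st => /andP[/is_perm_uniq us /eqP sz_s].
  by rewrite is_perm_st ?take_uniq // (size_takeD m n) ?eqxx.
- move=> m n s; rewrite mem_permsn => /andP[_ /eqP sz_s] i j; rewrite noninv_st /noninv.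
  rewrite (size_takeD m n) // sz_s.
  case: (ltnP j m) => [lt_jm|_]; last by rewrite andbF.
  case: ltnP => //= lt_ij; rewrite !nth_take ?(ltn_trans lt_ij) //.
  by rewrite ltn_addr.
- move=> m n s; rewrite !mem_permsn size_st => /andP[/is_perm_uniq us /eqP sz_s].
  by rewrite is_perm_st ?drop_uniq // size_drop sz_s addKn eqxx.
move=> m n s; rewrite mem_permsn => /andP[_ /eqP sz_s] i j; rewrite noninv_st /noninv.
by rewrite size_drop !nth_drop sz_s addKn ltn_add2l ltn_add2l.
Qed.

(** * The maps gamma and lambda *)

Lemma pvee_pbsl u v : pvee u v = pbsl (rcons u (size u).+1) v.
Proof. by rewrite /pbsl map_rcons cat_rcons. Qed.

Lemma is_perm_rcons u : is_perm u -> is_perm (rcons u (size u).+1).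
Proof. by move=> perm_u; rewrite /is_perm -cats1 size_cat iotaD; apply: perm_cat. Qed.

Lemma noninv_rcons u i j : is_perm u -> j < (size u).+1 ->
  noninv (rcons u (size u).+1) i j = if j < size u then noninv u i j else i < j.
Proof.
move=> perm_u lt_j; rewrite /noninv size_rcons !nth_rcons lt_j andbT.
case: (ltngtP j (size u)) lt_j => [lt_ju _||-> _]; [|by lia|].
  by case: (ltnP i j) => //= lt_ij; rewrite (ltn_trans lt_ij).
by case: (ltnP i (size u)) => //= /(is_perm_nth perm_u) /andP[].
Qed.

Lemma is_perm_gamma t : is_perm (gamma t).
Proof.
by elim: t => //= l IHl r IHr; rewrite pvee_pbsl is_perm_pbsl // is_perm_rcons.
Qed.

Lemma size_gamma t : size (gamma t) = tsize t.
Proof.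
by elim: t => //= l IHl r IHr; rewrite pvee_pbsl size_pbsl size_rcons IHl IHr.
Qed.

Lemma noninv_gamma t : noninv (gamma t) =2 ldesc t.
Proof.
elim: t => [|l IHl r IHr] i j /=; first by rewrite /noninv /= andbF.
rewrite pvee_pbsl noninv_pbsl ?is_perm_rcons ?is_perm_gamma //.
rewrite size_rcons size_gamma IHr.
case: (ltnP j (tsize l).+1) => [lt_j|lt_lj]; last by case: ltngtP lt_lj.
have := @noninv_rcons (gamma l) i j (is_perm_gamma l).
by rewrite size_gamma IHl => -> //; case: (ltngtP j (tsize l)) lt_j => //; lia.
Qed.

Lemma gamma_inj : injective gamma.
Proof.
move=> s t eq_st; apply: ldesc_inj => [|i j]; first by rewrite -!size_gamma eq_st.
by rewrite -!noninv_gamma eq_st.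
Qed.

Lemma gamma_tbsl s t : gamma (tbsl s t) = pbsl (gamma s) (gamma t).
Proof.
elim: s => //= l _ r IHr; rewrite IHr !pvee_pbsl /pbsl !map_cat -!map_comp -catA.
rewrite size_cat size_map; congr (_ ++ _).
by apply: eq_map => x /=; rewrite addnA.
Qed.

Lemma gamma_lcomb n : gamma (lcomb n) = idp n.
Proof.
elim: n => //= n ->; rewrite pvee_pbsl /pbsl cats0 (eq_map addn0) map_id size_iota.
by rewrite -cats1 -(iotaD 1 n 1) addn1.
Qed.

Lemma gamma_Cmap c : gamma (Cmap c) = Zmap c.
Proof. by elim: c => //= a c IHc; rewrite gamma_tbsl gamma_lcomb IHc. Qed.

Lemma pbsl_eq_gamma u v t : is_perm u -> is_perm v -> pbsl u v = gamma t ->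
  exists2 ab, ab \in cuts t & (u, v) = (gamma ab.1, gamma ab.2).
Proof.
move=> perm_u perm_v eq_t; have sz_t : size u + size v = tsize t.
  by rewrite -size_pbsl eq_t size_gamma.
have Et : t \in treesn (size u + size v) by rewrite mem_treesn sz_t.
have def_t : tbsl (tsplitl (size u) t) (tsplitr (size u) t) = t.
  apply: (op_parts tamari_splitting Et) => i j.
  by rewrite -noninv_gamma -eq_t noninv_pbsl //; case: ltnP => // _ /andP[].
exists (tsplitl (size u) t, tsplitr (size u) t); first by rewrite mem_cuts def_t.
have le_ut : size u <= tsize t by rewrite -sz_t leq_addr.
apply: pbsl_inj; rewrite ?size_gamma ?(tsize_tsplitl le_ut) ?(tsize_tsplitr le_ut) //=.
  by rewrite -sz_t addKn.
by rewrite eq_t -gamma_tbsl def_t.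
Qed.

Definition dominates (s : seq nat) (i j : nat) : bool :=
  (i < j < size s) && all (fun h => nth 0 s h < nth 0 s j) (iota i (j - i)).

Lemma dominatesP s i j :
  reflect (i < j < size s /\ forall h, i <= h < j -> nth 0 s h < nth 0 s j)
          (dominates s i j).
Proof.
apply: (iffP andP) => -[lt_ij dom_j]; split=> //.
  by move/allP: dom_j => dom_j h le_h; apply: dom_j; rewrite mem_iota; lia.
by apply/allP => h; rewrite mem_iota => le_h; apply: dom_j; lia.
Qed.

Lemma dominates_st s : dominates (st s) =2 dominates s.
Proof.
move=> i j; rewrite /dominates size_st; case: (boolP (i < j < _)) => //= lt_ij.
by apply: eq_in_all => h; rewrite mem_iota => le_h; rewrite st_ltn; lia.
Qed.

Lemma dominates_take m s i j : j < m -> dominates (take m s) i j = dominates s i j.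
Proof.
move=> lt_jm; rewrite /dominates size_take_min leq_min lt_jm /=; congr (_ && _).
by apply: eq_in_all => h; rewrite mem_iota => le_h; rewrite !nth_take //; lia.
Qed.

Lemma dominates_drop m s i j : dominates (drop m s) i j = dominates s (m + i) (m + j).
Proof.
rewrite /dominates size_drop subnDl ltn_add2l iotaDl all_map ltn_subRL.
by congr (_ && _); apply: eq_all => h /=; rewrite !nth_drop.
Qed.

Lemma bigmax_mem (s : seq nat) : s != [::] -> \max_(x <- s) x \in s.
Proof.
elim: s => // x s IHs _; rewrite big_cons inE.
have [->|s_neq0] := eqVneq s [::]; first by rewrite big_nil maxn0 eqxx.
by case: leqP; rewrite ?eqxx // IHs ?orbT.
Qed.

Definition max_index (s : seq nat) : nat := index (\max_(x <- s) x) s.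

Lemma max_index_ltn (s : seq nat) : s != [::] -> max_index s < size s.
Proof. by move=> s_neq0; rewrite index_mem bigmax_mem. Qed.

Lemma ltn_max_index (s : seq nat) i : uniq s -> i < size s -> i != max_index s ->
  nth 0 s i < nth 0 s (max_index s).
Proof.
move=> us lt_i ne_i; have s_neq0 : s != [::] by case: (s) lt_i.
rewrite ltn_neqAle nth_uniq ?max_index_ltn // ne_i nth_index ?bigmax_mem //.
by apply: (@leq_bigmax_seq _ s xpredT id); rewrite ?mem_nth.
Qed.

Lemma lam_recS k (s : seq nat) (j := max_index s) : s != [::] ->
  lam_rec k.+1 s = Node (lam_rec k (st (take j s))) (lam_rec k (st (drop j.+1 s))).
Proof. by rewrite /j; case: s {j}. Qed.

Lemma lam_rec_fuel k (s : seq nat) : size s <= k -> lam_rec k s = lambda s.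
Proof.
suff fuel_irr m n (u : seq nat) :
    size u <= m -> size u <= n -> lam_rec m u = lam_rec n u.
  by move=> le_sk; apply: fuel_irr.
elim: m n u => [|m IHm] n u; first by case: u => //; case: n.
have [-> | u_neq0] := eqVneq u [::]; first by case: n.
have lt_max := max_index_ltn u_neq0; case: n => [|n] le_m le_n; first by lia.
rewrite !lam_recS //.
by congr Node; apply: IHm; rewrite size_st ?size_take_min ?size_drop; lia.
Qed.

Lemma lambda_rec (s : seq nat) (j := max_index s) : s != [::] ->
  lambda s = Node (lambda (st (take j s))) (lambda (st (drop j.+1 s))).
Proof.
move=> s_neq0; have lt_max : j < size s by apply: max_index_ltn.
rewrite {1}/lambda -(ltn_predK lt_max) lam_recS //.
by congr Node; apply: lam_rec_fuel; rewrite size_st ?size_take_min ?size_drop; lia.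
Qed.

Lemma lambda_ind (P : seq nat -> Prop) : P [::] ->
  (forall s, s != [::] -> P (st (take (max_index s) s)) ->
     P (st (drop (max_index s).+1 s)) -> P s) -> forall s, P s.
Proof.
move=> P0 Pmax s; have [n] := ubnP (size s); elim: n s => // n IHn s lt_sn.
have [-> // | s_neq0] := eqVneq s [::]; have lt_max := max_index_ltn s_neq0.
by apply: Pmax => //; apply: IHn; rewrite size_st ?size_take_min ?size_drop; lia.
Qed.

Lemma tsize_lambda (s : seq nat) : tsize (lambda s) = size s.
Proof.
elim/lambda_ind: s => // s s_neq0 IHl IHr; have lt_max := max_index_ltn s_neq0.
by rewrite lambda_rec //= IHl IHr !size_st size_take_min size_drop; lia.
Qed.

Lemma ldesc_lambda (s : seq nat) : uniq s -> ldesc (lambda s) =2 dominates s.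
Proof.
elim/lambda_ind: s => [_ i j|s s_neq0 IHl IHr us i j].
  by rewrite /dominates /= andbF.
have lt_max := max_index_ltn s_neq0; set m := max_index s in IHl IHr lt_max *.
have ust (u : seq nat) : uniq u -> uniq (st u) by move/is_perm_st/is_perm_uniq.
rewrite lambda_rec // -/m /= tsize_lambda size_st size_take lt_max.
case: (ltngtP j m) => [lt_jm|lt_mj|->].
- by rewrite IHl ?ust ?take_uniq // dominates_st dominates_take.
- rewrite IHr ?ust ?drop_uniq // dominates_st dominates_drop (subnKC lt_mj).
  have [lt_mi|le_im] /= := ltnP m i; first by rewrite subnKC.
  apply/esym/negbTE/dominatesP => -[/andP[_ lt_js] dom_j].
  have lt_s : nth 0 s j < nth 0 s m by rewrite ltn_max_index // gtn_eqF.
  by have := dom_j m; rewrite le_im lt_mj ltnNge ltnW // => /(_ isT).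
apply/idP/dominatesP => [lt_im|[/andP[]]//].
split=> [|h le_h]; first by rewrite lt_im.
by apply: ltn_max_index; lia.
Qed.

Lemma lambda_gamma_galois s t : is_perm s -> size s = tsize t ->
  weak_le s (gamma t) = tam_le (lambda s) t.
Proof.
move=> perm_s eq_sz; have us := is_perm_uniq perm_s.
have ug := is_perm_uniq (is_perm_gamma t).
have eq_sg : size s = size (gamma t) by rewrite size_gamma.
apply/(weak_leP us ug eq_sg)/tam_leP => [sub_s i j ld_ij|sub_l i j].
  have lt_ij := ldesc_ltn ld_ij; rewrite ldesc_lambda //; apply/dominatesP.
  split=> [|h le_h]; first by rewrite eq_sz.
  have := sub_s h j; rewrite noninv_gamma => /(_ (ldesc_between ld_ij le_h)).
  by case/andP.
rewrite noninv_gamma => /sub_l; rewrite ldesc_lambda // => /dominatesP[lt_ij dom_j].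
by rewrite /noninv lt_ij dom_j //; lia.
Qed.

Lemma Lset_lambda s : uniq s -> Lset (lambda s) = Des s.
Proof.
move=> us; rewrite LsetE tsize_lambda.
apply: eq_in_filter => i; rewrite mem_iota => le_i.
have lt_ii : i.-1 < i < size s by move: le_i; case: (size s) => [|n] /=; lia.
have ne_ii : nth 0 s i != nth 0 s i.-1 by rewrite nth_uniq //; lia.
rewrite ldesc_lambda // /dominates lt_ii (_ : i - i.-1 = 1) /= ?andbT; last by lia.
by rewrite -leqNgt ltn_neqAle ne_ii.
Qed.

(** * Monomial bases of [SSym], [YSym] and [QSym] *)

Local Open Scope ring_scope.

HB.instance Definition _ :=
  GRing.isLinear.Build rat SSym _ _ DeltaS (fglift_is_linear _).
HB.instance Definition _ :=
  GRing.isLinear.Build rat SSym _ _ epsS (fglift_is_linear _).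
HB.instance Definition _ :=
  GRing.isLinear.Build rat YSym _ _ DeltaY (fglift_is_linear _).
HB.instance Definition _ :=
  GRing.isLinear.Build rat YSym _ _ epsY (fglift_is_linear _).
HB.instance Definition _ :=
  GRing.isLinear.Build rat QSym _ _ DeltaQ (fglift_is_linear _).
HB.instance Definition _ :=
  GRing.isLinear.Build rat QSym _ _ epsQ (fglift_is_linear _).
HB.instance Definition _ :=
  GRing.isLinear.Build rat SSym _ _ LambdaM (fglift_is_linear _).
HB.instance Definition _ :=
  GRing.isLinear.Build rat YSym _ _ LM (fglift_is_linear _).
HB.instance Definition _ :=
  GRing.isLinear.Build rat SSym _ _ DM (fglift_is_linear _).
HB.instance Definition _ :=
  GRing.isLinear.Build rat QSym _ _ CM (fglift_is_linear _).
HB.instance Definition _ :=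
  GRing.isLinear.Build rat QSym _ _ ZM (fglift_is_linear _).

Lemma val_mkperm s : is_perm s -> val (mkperm s) = s.
Proof. exact: insubdK. Qed.

Lemma val_mkcomp c : is_comp c -> val (mkcomp c) = c.
Proof. exact: insubdK. Qed.

Lemma FS_upsum n : {in permsn n, FS =1 upsum (permsn n) weak_le MS}.
Proof.
apply: (upsum_monomial (leE := @weak_leN n)) => [|||u].
- exact: permutations_uniq.
- exact: level_poset weak_splitting n.
- by [].
have /andP[_ /eqP size_u] : is_perm (val u) && (size (val u) == n).
  by rewrite -mem_permsn; apply: (valP u).
by rewrite /MS size_u /to_permn valKd.
Qed.

Lemma FY_upsum n : {in treesn n, FY =1 upsum (treesn n) tam_le MY}.
Proof.
apply: (upsum_monomial (leE := @tam_leN n)) => [|||u].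
- exact: treesn_uniq.
- exact: level_poset tamari_splitting n.
- exact: tam_leNE.
have size_u : tsize (val u) = n by apply/eqP; rewrite -mem_treesn; apply: (valP u).
by rewrite /MY size_u /to_treen valKd.
Qed.

Lemma YSym_linear_ext (V : lmodType rat) (f g : {linear YSym -> V}) :
  (forall t, f (MY t) = g (MY t)) -> f =1 g.
Proof.
move=> eq_fg; apply: freeg_linear_ext => t; rewrite -/(FY t).
rewrite (@FY_upsum (tsize t)) ?mem_treesn // !linear_sum.
by apply: eq_bigr => u _.
Qed.

Lemma DeltaS_FS n : {in permsn n, forall s,
  DeltaS (FS s) = \sum_(p < n.+1) tens (FS (st (take p s))) (FS (st (drop p s)))}.
Proof.
move=> s; rewrite mem_permsn => /andP[perm_s /eqP<-].
rewrite /DeltaS fglift1 val_mkperm //; apply: eq_bigr => p _.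
by rewrite tens1.
Qed.

Lemma DeltaY_FY n : {in treesn n, forall t,
  DeltaY (FY t) = \sum_(p < n.+1) tens (FY (tsplitl p t)) (FY (tsplitr p t))}.
Proof.
move=> t; rewrite mem_treesn => /eqP<-.
rewrite /DeltaY fglift1 splitsE big_map -/(index_iota 0 (tsize t).+1) big_mkord.
by apply: eq_bigr => p _; rewrite tens1 -surjective_pairing.
Qed.

Lemma DeltaS_MS s (D : seq (seq nat * seq nat)) : is_perm s -> uniq D ->
  (forall u v, ((u, v) \in D) = [&& is_perm u, is_perm v & pbsl u v == s]) ->
  DeltaS (MS s) = \sum_(uv <- D) tens (MS uv.1) (MS uv.2).
Proof.
rewrite -mem_permsn_size => Es uniq_D mem_D.
rewrite (coproduct_monomial weak_splitting FS_upsum (@DeltaS_FS _) Es) -big_filter.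
apply/perm_big/uniq_perm => //.
  exact/filter_uniq/(level_pairs_uniq weak_splitting).
move=> [u v]; rewrite mem_filter mem_D /=.
apply/andP/and3P => [[pbsl_s]|[perm_u perm_v pbsl_s]].
  by case/mem_level_pairs => m [n [_]]; rewrite !mem_permsn => /andP[-> _] /andP[-> _].
split=> //; apply/mem_level_pairs; exists (size u), (size v).
by rewrite -size_pbsl (eqP pbsl_s) !mem_permsn_size.
Qed.

Lemma DeltaY_MY t : DeltaY (MY t) = \sum_(ab <- cuts t) tens (MY ab.1) (MY ab.2).
Proof.
rewrite (coproduct_monomial tamari_splitting FY_upsum (@DeltaY_FY _)
  (mem_treesn_tsize t)) -big_filter; apply/perm_big/uniq_perm.
- exact/filter_uniq/(level_pairs_uniq tamari_splitting).
- exact: cuts_uniq.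
move=> [a b]; rewrite mem_filter mem_cuts andb_idr // => /eqP <-.
apply/mem_level_pairs; exists (tsize a), (tsize b).
by rewrite tsize_tbsl !mem_treesn_tsize.
Qed.

Lemma DeltaS_MS_gamma t :
  DeltaS (MS (gamma t)) = \sum_(ab <- cuts t) tens (MS (gamma ab.1)) (MS (gamma ab.2)).
Proof.
rewrite (DeltaS_MS (D := [seq (gamma ab.1, gamma ab.2) | ab <- cuts t])) ?big_map //.
- exact: is_perm_gamma.
- by rewrite map_inj_uniq ?cuts_uniq // => -[a b] [c d] /= [/gamma_inj-> /gamma_inj->].
move=> u v; apply/mapP/and3P => [[[a b] + [-> ->]]|[perm_u perm_v /eqP eq_t]].
  by rewrite mem_cuts !is_perm_gamma -gamma_tbsl => /eqP->.
by have [ab cut_ab eq_uv] := pbsl_eq_gamma perm_u perm_v eq_t; exists ab.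
Qed.

Lemma epsS_MS s : is_perm s -> epsS (MS s) = (size s == 0%N)%:R.
Proof.
rewrite -mem_permsn_size.
apply: (counit_monomial weak_splitting FS_upsum (e := [::])) => // u.
rewrite mem_permsn => /andP[perm_u /eqP<-].
by rewrite /= /epsS fglift1 val_mkperm.
Qed.

Lemma epsY_MY t : epsY (MY t) = (tsize t == 0%N)%:R.
Proof.
apply: (counit_monomial tamari_splitting FY_upsum (e := Leaf))
  (mem_treesn_tsize t) => // u.
by rewrite mem_treesn => /eqP<-; rewrite /= /epsY fglift1; case: u.
Qed.

(** * Splittings of the Hopf morphisms *)

Lemma LambdaM_MS_gamma t : LambdaM (MS (gamma t)) = MY t.
Proof.
have gamma_permsn : {in treesn (tsize t), forall u, gamma u \in permsn (tsize t)}.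
  by move=> u; rewrite mem_treesn mem_permsn is_perm_gamma size_gamma.
apply: (linear_monomial_galois (permutations_uniq _) (level_poset weak_splitting _)
  (@FS_upsum _) (treesn_uniq _) (in2W gamma_inj) gamma_permsn)
  (mem_treesn_tsize t) => s.
rewrite mem_permsn => /andP[perm_s /eqP size_s].
rewrite /= /LambdaM fglift1 val_mkperm //.
rewrite (@FY_upsum (tsize t)) ?mem_treesn ?tsize_lambda ?size_s //.
apply: eq_in_bigl => u; rewrite mem_treesn => /eqP size_u.
by rewrite lambda_gamma_galois // size_s.
Qed.

Lemma LM_MY_Cmap c : is_comp c -> LM (MY (Cmap c)) = MQ c.
Proof.
move=> c_comp; set n := sumn c; set C := fun T => Cmap (comp_of_set n T).
have subsets_uniq : uniq (subseqs (iota 1 n.-1)) by apply/subseqs_uniq/iota_uniq.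
have C_inj : {in subseqs (iota 1 n.-1) &, injective C}.
  move=> S T /comp_of_set_spec[_ _ defS] /comp_of_set_spec[_ _ defT] eqC.
  by rewrite -defS -defT -/(C S) eqC.
have C_treesn : {in subseqs (iota 1 n.-1), forall T, C T \in treesn n}.
  by move=> T /comp_of_set_spec[_ sum_n _]; rewrite mem_treesn tsize_Cmap sum_n.
suff LM_C : {in subseqs (iota 1 n.-1), forall T, LM (MY (C T)) = MQ (comp_of_set n T)}.
  have := LM_C (Lset (Cmap c)); rewrite /C /n comp_of_set_Lset //; apply.
  by rewrite mem_subseqs -(tsize_Cmap c); apply: filter_subseq.
apply: (linear_monomial_galois (treesn_uniq _) (level_poset tamari_splitting n)
  (@FY_upsum n) subsets_uniq C_inj C_treesn) => t.
rewrite mem_treesn /= /LM fglift1 => /eqP size_t; rewrite /FQ size_t.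
apply: eq_in_bigl => T /comp_of_set_spec[_ sum_n defT].
by rewrite tam_le_Cmap ?sum_n // defT.
Qed.

Lemma Gamma_exists :
  exists G : {linear YSym -> SSym}, forall t : tree, G (MY t) = MS (gamma t).
Proof.
pose G : {linear YSym -> SSym} :=
  fglift (fun t => upsum (treesn (tsize t)) tam_le (MS \o gamma) t).
exists G => t; apply: (linear_monomial (f := G) (k := MS \o gamma) (treesn_uniq _)
  (level_poset tamari_splitting _) (@FY_upsum _)) (mem_treesn_tsize t) => u.
by rewrite mem_treesn /= fglift1 => /eqP->.
Qed.

Lemma DM_LambdaM v : DM v = LM (LambdaM v).
Proof.
apply: (freeg_linear_ext (f := DM) (g := LM \o LambdaM)) => s /=.
rewrite /DM /LambdaM /LM !fglift1 tsize_lambda Lset_lambda //.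
exact/is_perm_uniq/(valP s).
Qed.

Lemma CM1 c : CM << c >> = MY (Cmap (val c)).
Proof. exact: fglift1. Qed.

Lemma LM_CM v : LM (CM v) = v.
Proof.
apply: (freeg_linear_ext (f := LM \o CM) (g := idfun)) => c /=.
by rewrite CM1 LM_MY_Cmap ?(valP c) // /MQ /mkcomp valKd.
Qed.

Lemma DeltaY_CM v : DeltaY (CM v) = tmap CM CM (DeltaQ v).
Proof.
apply: (freeg_linear_ext (f := DeltaY \o CM) (g := tmap CM CM \o DeltaQ)) => c /=.
rewrite CM1 DeltaY_MY cuts_Cmap ?(valP c) // big_map /DeltaQ fglift1 linear_sum.
rewrite -/(index_iota 0 (size (val c)).+1) big_mkord; apply: eq_bigr => i _.
have := valP c; rewrite -[X in is_comp X](cat_take_drop i) /is_comp all_cat.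
by case/andP=> take_comp drop_comp; rewrite [RHS]tmap1 !CM1 !val_mkcomp.
Qed.

Lemma epsY_CM v : epsY (CM v) = epsQ v.
Proof.
apply: (freeg_linear_ext (f := epsY \o CM) (g := epsQ)) => c /=.
rewrite CM1 epsY_MY tsize_Cmap /epsQ fglift1 -[val c == _]negbK.
by rewrite -comp_sumn_gt0 ?(valP c) // lt0n negbK.
Qed.

Section Gamma.

Variable Gamma : {linear YSym -> SSym}.
Hypothesis GammaM : forall t, Gamma (MY t) = MS (gamma t).

Lemma Gamma_CM v : Gamma (CM v) = ZM v.
Proof.
apply: (freeg_linear_ext (f := Gamma \o CM) (g := ZM)) => c /=.
by rewrite CM1 GammaM gamma_Cmap /ZM fglift1.
Qed.

Lemma LambdaM_Gamma v : LambdaM (Gamma v) = v.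
Proof.
apply: (YSym_linear_ext (f := LambdaM \o Gamma) (g := idfun)) => t /=.
by rewrite GammaM LambdaM_MS_gamma.
Qed.

Lemma DeltaS_Gamma v : DeltaS (Gamma v) = tmap Gamma Gamma (DeltaY v).
Proof.
apply: (YSym_linear_ext (f := DeltaS \o Gamma)
  (g := tmap Gamma Gamma \o DeltaY)) => t /=.
rewrite GammaM DeltaS_MS_gamma DeltaY_MY linear_sum; apply: eq_bigr => ab _.
by rewrite -!GammaM [RHS]tmap_tens.
Qed.

Lemma epsS_Gamma v : epsS (Gamma v) = epsY v.
Proof.
apply: (YSym_linear_ext (f := epsS \o Gamma) (g := epsY)) => t /=.
by rewrite GammaM epsY_MY epsS_MS ?is_perm_gamma // size_gamma.
Qed.

End Gamma.

Lemma DM_ZM v : DM (ZM v) = v.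
Proof.
have [G GM] := Gamma_exists.
by rewrite -(Gamma_CM GM) DM_LambdaM (LambdaM_Gamma GM) LM_CM.
Qed.

Lemma DeltaS_ZM v : DeltaS (ZM v) = tmap ZM ZM (DeltaQ v).
Proof.
have [G GM] := Gamma_exists.
rewrite -(Gamma_CM GM) (DeltaS_Gamma GM) DeltaY_CM tmap_comp.
by apply: eq_tmap => u /=; rewrite (Gamma_CM GM).
Qed.

Lemma epsS_ZM v : epsS (ZM v) = epsQ v.
Proof.
have [G GM] := Gamma_exists.
by rewrite -(Gamma_CM GM) (epsS_Gamma GM) epsY_CM.
Qed.

Theorem theorem7p1 :
  (* existence of the linear map Gamma with Gamma(M_t) = M_{gamma(t)} *)
  (exists G : {linear YSym -> SSym}, forall t : tree, G (MY t) = MS (gamma t)) /\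
  (* and for the (unique) such linear map Gamma: *)
  forall G : {linear YSym -> SSym},
    (forall t : tree, G (MY t) = MS (gamma t)) ->
    [/\ (* injectivity *)
        [/\ injective CM, injective G & injective ZM],
        (* morphisms of coalgebras (coproduct and counit) *)
        [/\ (forall v : QSym, DeltaY (CM v) = tmap CM CM (DeltaQ v) /\ epsY (CM v) = epsQ v),
            (forall v : YSym, DeltaS (G v) = tmap G G (DeltaY v) /\ epsS (G v) = epsY v)
          & (forall v : QSym, DeltaS (ZM v) = tmap ZM ZM (DeltaQ v) /\ epsS (ZM v) = epsQ v)],
        (* Gamma o C = Z *)
        (forall v : QSym, G (CM v) = ZM v)
      & (* splittings *)
        [/\ forall v : QSym, LM (CM v) = v,
            forall v : YSym, LambdaM (G v) = v
          & forall v : QSym, DM (ZM v) = v]].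
Proof.
split=> [|G GM]; first exact: Gamma_exists.
split.
- by split; [apply: can_inj LM_CM|apply: can_inj (LambdaM_Gamma GM)|apply: can_inj DM_ZM].
- split=> v; split.
  + exact: DeltaY_CM.
  + exact: epsY_CM.
  + exact: DeltaS_Gamma.
  + exact: epsS_Gamma.
  + exact: DeltaS_ZM.
  + exact: epsS_ZM.
- exact: Gamma_CM.
by split; [exact: LM_CM|exact: LambdaM_Gamma|exact: DM_ZM].
Qed.
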